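(* Let $L$ be a positive integer and let $N\subset M\subset\mathbb{R}^K$ be as in the context. There exists a constant $C'$ such that the following holds. Let $I=[0,l]$ be an interval of length $l\le\frac1L$, let $\sigma_1:I\to M$ be a Lipschitz curve with $|\sigma_1'|\le L$ and with one endpoint on $N$, namely $\sigma_1(l)\in N$, and let $\sigma_2:I\to M$ be the minimizing geodesic from $\sigma_1(0)$ to $N$, i.e. $\sigma_2(0)=\sigma_1(0)$, $\sigma_2(l)\in N$ and $\sigma_2'(l)\perp N$. Then $$\mathrm{dist}^2(\sigma_1,\sigma_2)\le C'\big(E(\sigma_1)-E(\sigma_2)\big).$$
   Context: $(M,g)$ is a complete, homogeneously regular Riemannian manifold isometrically embedded in $\mathbb{R}^K$, and $N\subset M$ is a closed (compact, without boundary) submanifold. Standing normalizations: (M1) $\sup_M\|A_M\|\le\frac1{16}$ and $\sup_N\|A_N\|\le\frac1{16}$, where $A_M,A_N$ are the second fundamental forms of the embeddings $M\subset\mathbb{R}^K$ and $N\subset\mathbb{R}^K$; (M2) the injectivity radius of $M$ is at least $8$ and the (sectional) curvature of $M$ is at most $\frac1{64}$; (M2)$'$ the injectivity radius of $N$ is at least $4$ and the focal radius of $N$ is at least $4$ (this is understood to guarantee that points at distance at most $2$ from $N$ have a unique minimizing geodesic to $N$); (M3) for $x,y\in M$ with $|x-y|\le8$, $\mathrm{dist}_M(x,y)\le2|x-y|$; (M3)$'$ for $x,y\in N$ with $|x-y|\le8$, $\mathrm{dist}_N(x,y)\le2|x-y|$. Here $|x-y|$ is the Euclidean distance in $\mathbb{R}^K$.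 Geodesics are parametrized with constant speed; the minimizing geodesic from $p$ to $N$ is the geodesic from $p$ to a point of $N$ whose length equals $\mathrm{dist}_M(p,N)$. For curves on $I=[0,l]$, $E(\sigma)=\int_I|\sigma'|^2ds$ and $\mathrm{dist}^2(\sigma_1,\sigma_2)=\int_I|\sigma_1-\sigma_2|^2+|\sigma_1'-\sigma_2'|^2\,ds$ (the squared $W^{1,2}$-norm of $\sigma_1-\sigma_2$ in $\mathbb{R}^K$). *)

(* Defs.v *)
From HB Require Import structures.
From mathcomp Require Import all_boot all_order all_algebra.
From mathcomp Require Import all_classical all_reals all_analysis.

Set Implicit Arguments.
Unset Strict Implicit.
Unset Printing Implicit Defensive.

Import Order.TTheory GRing.Theory Num.Theory numFieldNormedType.Exports.

Local Open Scope classical_set_scope.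
Local Open Scope ring_scope.

(* The library norm on 'rV[R]_k is the sup norm, hence a Euclidean one here. *)
Definition dot {R : realType} {k : nat} (u v : 'rV[R]_k) : R :=
  \sum_(i < k) u 0 i * v 0 i.

Definition enorm {R : realType} {k : nat} (u : 'rV[R]_k) : R :=
  Num.sqrt (dot u u).

Definition orthogonal_to {R : realType} {k : nat}
    (u : 'rV[R]_k) (S : set 'rV[R]_k) : Prop :=
  forall w, S w -> dot u w = 0.

(* Orthogonal projection; only used when S is a linear subspace. *)
Definition oproj {R : realType} {k : nat}
    (S : set 'rV[R]_k) (v : 'rV[R]_k) : 'rV[R]_k :=
  get [set w | S w /\ orthogonal_to (v - w) S].

(* Smoothness.  V is always finite dimensional below, where continuity of all
   iterated directional derivatives up to order j is the usual C^j. *)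
Fixpoint Ck {R : realType} {V W : normedModType R} (j : nat)
    (U : set V) (f : V -> W) : Prop :=
  match j with
  | 0%N => forall x, U x -> {for x, continuous f}
  | i.+1 => (forall x v, U x -> derivable f x v) /\
            (forall v, Ck i U (fun x => 'D_v f x))
  end.

(* Smooth maps and diffeomorphisms between arbitrary subsets of Euclidean
   spaces: a map is smooth if it extends locally to a smooth map on an open
   set of the ambient space. *)
Definition smooth_on {R : realType} {V W : normedModType R}
    (X : set V) (f : V -> W) : Prop :=
  forall x, X x -> exists (U : set V) (F : V -> W),
    [/\ open U, U x, forall j, Ck j U F & forall y, X y -> U y -> F y = f y].

Definition diffeo {R : realType} {V W : normedModType R}
    (X : set V) (Y : set W) (f : V -> W) : Prop :=
  [/\ smooth_on X f, f @` X = Y &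
      exists2 g : W -> V, smooth_on Y g & forall x, X x -> g (f x) = x].

(* phi parametrizes, over the open set V of R^m, a relatively open part of M *)
Definition local_param {R : realType} {k : nat} (m : nat) (M : set 'rV[R]_k)
    (V : set 'rV[R]_m) (phi : 'rV[R]_m -> 'rV[R]_k) : Prop :=
  open V /\ exists2 U : set 'rV[R]_k, open U & diffeo V (M `&` U) phi.

Definition submanifold {R : realType} {k : nat} (m : nat)
    (M : set 'rV[R]_k) : Prop :=
  forall p, M p -> exists V phi, local_param (m := m) M V phi /\ (phi @` V) p.

Definition tangent {R : realType} {k : nat} (m : nat) (M : set 'rV[R]_k)
    (p : 'rV[R]_k) : set 'rV[R]_k :=
  [set w | exists V (phi : 'rV[R]_m -> 'rV[R]_k) x a,
    [/\ local_param M V phi, V x, phi x = p & w = 'D_a phi x]].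

(* The second fundamental form (D_X Y)^perp of M in R^k, evaluated at phi x on
   the coordinate vector fields X = d phi(a), Y = d phi(b). *)
Definition sff {R : realType} {k m : nat} (M : set 'rV[R]_k)
    (phi : 'rV[R]_m -> 'rV[R]_k) (a b x : 'rV[R]_m) : 'rV[R]_k :=
  let w := 'D_a (fun y => 'D_b phi y) x in
  w - oproj (tangent m M (phi x)) w.

(* sup_M ||A_M||, with the operator norm of the bilinear form at each point *)
Definition sup_sff {R : realType} {k : nat} (m : nat)
    (M : set 'rV[R]_k) : \bar R :=
  ereal_sup [set e | exists V (phi : 'rV[R]_m -> 'rV[R]_k) x a b,
    [/\ local_param M V phi, V x, enorm ('D_a phi x) = 1,
        enorm ('D_b phi x) = 1 & e = (enorm (sff M phi a b x))%:E]].

(* The Levi-Civita connection of the induced metric is the tangential part of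
   the derivative in R^k; Z is a vector field on M, read through phi. *)
Definition covd {R : realType} {k m : nat} (M : set 'rV[R]_k)
    (phi : 'rV[R]_m -> 'rV[R]_k) (a : 'rV[R]_m)
    (Z : 'rV[R]_m -> 'rV[R]_k) (x : 'rV[R]_m) : 'rV[R]_k :=
  oproj (tangent m M (phi x)) ('D_a Z x).

(* R(X,Y)Z for the commuting coordinate fields X, Y, Z = d phi(a), d phi(b),
   d phi(c) *)
Definition curvature {R : realType} {k m : nat} (M : set 'rV[R]_k)
    (phi : 'rV[R]_m -> 'rV[R]_k) (a b c x : 'rV[R]_m) : 'rV[R]_k :=
  let Z := fun y => 'D_c phi y in
  covd M phi a (covd M phi b Z) x - covd M phi b (covd M phi a Z) x.

Definition gram {R : realType} {k : nat} (u v : 'rV[R]_k) : R :=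
  dot u u * dot v v - dot u v ^+ 2.

Definition sectional_curvature_le {R : realType} {k : nat} (m : nat)
    (M : set 'rV[R]_k) (c : R) : Prop :=
  forall V (phi : 'rV[R]_m -> 'rV[R]_k) x a b,
    local_param M V phi -> V x ->
    gram ('D_a phi x) ('D_b phi x) != 0 ->
    dot (curvature M phi a b b x) ('D_a phi x)
      / gram ('D_a phi x) ('D_b phi x) <= c.

(* Derivative of a curve relative to its interval of definition, one-sided at
   the endpoints; values of gam outside I play no role. *)
Definition cderiv {R : realType} {k : nat} (I : set R)
    (gam : R -> 'rV[R]_k) (t : R) : 'rV[R]_k :=
  lim ((fun s => (s - t)^-1 *: (gam s - gam t)) @ within I t^').

Definition curve_length {R : realType} {k : nat} (l : R)
    (gam : R -> 'rV[R]_k) : R :=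
  \int[@lebesgue_measure R]_(t in `[0, l]) enorm (cderiv `[0, l] gam t).

Definition energy {R : realType} {k : nat} (l : R)
    (gam : R -> 'rV[R]_k) : R :=
  \int[@lebesgue_measure R]_(t in `[0, l]) enorm (cderiv `[0, l] gam t) ^+ 2.

(* The squared W^{1,2} distance of two curves on [0, l]. *)
Definition sqdist_curves {R : realType} {k : nat} (l : R)
    (gam1 gam2 : R -> 'rV[R]_k) : R :=
  \int[@lebesgue_measure R]_(t in `[0, l])
    (enorm (gam1 t - gam2 t) ^+ 2
     + enorm (cderiv `[0, l] gam1 t - cderiv `[0, l] gam2 t) ^+ 2).

(* Riemannian distance, +oo between distinct components of M. *)
Definition rdist {R : realType} {k : nat} (M : set 'rV[R]_k)
    (p q : 'rV[R]_k) : \bar R :=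
  ereal_inf [set (curve_length 1 gam)%:E | gam in
    [set gam : R -> 'rV[R]_k |
      [/\ [lipschitz gam t | t in `[0, 1]],
          (forall t, t \in `[0, 1] -> M (gam t)), gam 0 = p & gam 1 = q]]].

Definition rdist_set {R : realType} {k : nat} (M N : set 'rV[R]_k)
    (p : 'rV[R]_k) : \bar R :=
  ereal_inf [set rdist M p q | q in N].

Definition complete_submanifold {R : realType} {k : nat}
    (M : set 'rV[R]_k) : Prop :=
  forall u : nat -> 'rV[R]_k, (forall i, M (u i)) ->
    (forall e : R, 0 < e -> exists n0, forall i j,
      (n0 <= i)%N -> (n0 <= j)%N -> (rdist M (u i) (u j) < e%:E)%E) ->
    exists2 p, M p & forall e : R, 0 < e -> exists n0, forall i,
      (n0 <= i)%N -> (rdist M (u i) p < e%:E)%E.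

(* Homogeneous regularity in the sense of Morrey: charts over the unit ball,
   centred at any given point, with uniformly bounded metric coefficients. *)
Definition homogeneously_regular {R : realType} {k : nat} (m : nat)
    (M : set 'rV[R]_k) : Prop :=
  exists c C : R, 0 < c /\ forall p, M p ->
    exists phi : 'rV[R]_m -> 'rV[R]_k,
      [/\ local_param M [set x | enorm x < 1] phi, phi 0 = p &
          forall x xi, enorm x < 1 ->
            c * enorm xi ^+ 2 <= enorm ('D_xi phi x) ^+ 2 <= C * enorm xi ^+ 2].

(* Vanishing covariant acceleration; such a curve has constant speed. *)
Definition geodesic {R : realType} {k : nat} (m : nat) (M : set 'rV[R]_k)
    (I : set R) (gam : R -> 'rV[R]_k) : Prop :=
  smooth_on I gam /\
  forall t, I t -> M (gam t) /\
    orthogonal_to (cderiv I (cderiv I gam) t) (tangent m M (gam t)).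

Definition rexp {R : realType} {k : nat} (m : nat) (M : set 'rV[R]_k)
    (p v : 'rV[R]_k) : 'rV[R]_k :=
  get [set q | exists gam : R -> 'rV[R]_k,
    [/\ geodesic m M `[0, 1] gam, gam 0 = p,
        cderiv `[0, 1] gam 0 = v & gam 1 = q]].

Definition injectivity_radius_at {R : realType} {k : nat} (m : nat)
    (M : set 'rV[R]_k) (p : 'rV[R]_k) : \bar R :=
  ereal_sup [set r%:E | r in [set r : R | 0 < r /\
    let B := [set v | tangent m M p v /\ enorm v < r] in
    diffeo B (rexp m M p @` B) (rexp m M p)]].

Definition injectivity_radius {R : realType} {k : nat} (m : nat)
    (M : set 'rV[R]_k) : \bar R :=
  ereal_inf [set injectivity_radius_at m M p | p in M].

(* The normal bundle of N in M, a submanifold of R^k x R^k of dimension dim M: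
   row_mx p v stands for the normal vector v at p. *)
Definition normal_bundle {R : realType} {k : nat} (m : nat) (M : set 'rV[R]_k)
    (n : nat) (N : set 'rV[R]_k) : set 'rV[R]_(k + k) :=
  [set z | [/\ N (lsubmx z), tangent m M (lsubmx z) (rsubmx z) &
               orthogonal_to (rsubmx z) (tangent n N (lsubmx z))]].

(* Critical points of the normal exponential map (p, v) |-> exp_p v. *)
Definition focal_vector {R : realType} {k : nat} (m : nat) (M : set 'rV[R]_k)
    (n : nat) (N : set 'rV[R]_k) : set 'rV[R]_(k + k) :=
  [set z | exists V (psi : 'rV[R]_m -> 'rV[R]_(k + k)) y a,
    [/\ local_param (normal_bundle m M n N) V psi, V y, psi y = z, a != 0 &
        'D_a (fun x => rexp m M (lsubmx (psi x)) (rsubmx (psi x))) y = 0]].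

Definition focal_radius {R : realType} {k : nat} (m : nat) (M : set 'rV[R]_k)
    (n : nat) (N : set 'rV[R]_k) : \bar R :=
  ereal_inf [set (enorm (rsubmx z))%:E | z in focal_vector m M n N].

Definition minimizing_geodesic_to {R : realType} {k : nat} (m : nat)
    (M N : set 'rV[R]_k) (l : R) (p : 'rV[R]_k)
    (gam : R -> 'rV[R]_k) : Prop :=
  [/\ geodesic m M `[0, l] gam, gam 0 = p, N (gam l) &
      (curve_length l gam)%:E = rdist_set M N p].

Definition unique_minimizing_geodesic_to {R : realType} {k : nat} (m : nat)
    (M N : set 'rV[R]_k) (p : 'rV[R]_k) : Prop :=
  exists2 gam : R -> 'rV[R]_k, minimizing_geodesic_to m M N 1 p gam &
    forall gam', minimizing_geodesic_to m M N 1 p gam' ->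
      {in `[0, 1], gam' =1 gam}.

(* Main.v *)
Require Import Defs.
From HB Require Import structures.
From mathcomp Require Import all_boot all_order all_algebra.
From mathcomp Require Import all_classical all_reals all_analysis measurable_realfun.
From mathcomp Require Import ring lra.

Set Implicit Arguments.
Unset Strict Implicit.
Unset Printing Implicit Defensive.

Import Order.TTheory GRing.Theory Num.Theory numFieldNormedType.Exports.
Import HBNNSimple.

Local Open Scope classical_set_scope.
Local Open Scope ring_scope.

(** Let b be the velocity of the geodesic sigma2 and D = sigma1 - sigma2, so that
    D 0 = 0.  Expanding |sigma1'|^2 = |b + D'|^2 and integrating <b, D'> by parts,

      E(sigma1) - E(sigma2) = int |D'|^2 + 2 <b l, D l> - 2 int <b', D>.

    The last two terms look linear in D but are quadratic: b' is normal to M along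
    sigma2, b l is normal to N, and the difference y - x of two points of a submanifold
    has a normal component of size at most |y - x|^2 / 3 at x ([normal_deviation]).
    Since |b| <= L ([minimizing_geodesic_speed]), |b'| <= L^2 / 12 and l <= 1 / L, a
    Poincare inequality for D absorbs both terms into int |D'|^2.

    Normal deviation.  The second fundamental form is the rate at which tangent spaces
    turn, so along a curve in M of length len issuing from p the tangent spaces turn by at
    most c * len, for any c > 1/16 ([tilt_le_curve]).  A vector nu normal at p therefore
    sees at most the fraction c * len of the velocity of the curve, and integrating once
    more gives |<nu, q - p>| <= c len^2 |nu| ([normal_deviation_curve]).  The comparison
    of intrinsic and Euclidean distances allows len to be taken close to 2 |q - p|.
    Almost-minimal curves are merely Lipschitz.  Rather than differentiating tangent
    spaces along them, one propagates both bounds by continuous induction from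
    first-order expansions in a chart around each point ([tilt_le_local],
    [submanifold_secant]).  The expansion of tangent spaces also bounds the acceleration
    of a geodesic ([geodesic_acceleration_le]).

    Integration.  The integration by parts and the Poincare inequality are performed
    together by means of the potential

      Psi t = 2 <b t, D t> + (3/4) |D t|^2 / (t + 1 / (10 L)).

    It vanishes at 0, it is nonnegative at l by the normal deviation from N, and almost
    everywhere Psi' <= |sigma1'|^2 - |sigma2'|^2 - (|D|^2 + |D'|^2) / 20
    ([weight_inequality]); integrating this inequality gives the theorem with C' = 20
    ([energy_gap_of_potential]).  What makes it legitimate for Lipschitz curves is
    [lipschitz_FTC]: after adding a linear function, a Lipschitz function generates an
    absolutely continuous Stieltjes measure, and its Radon-Nikodym density is its
    derivative by the Lebesgue differentiation theorem. *)

(** * Euclidean inner product and orthogonal projection *)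

Section Dot.
Variables (R : realType) (k : nat).
Implicit Types u v w : 'rV[R]_k.

Lemma dotC u v : dot u v = dot v u.
Proof. by apply: eq_bigr => i _; rewrite mulrC. Qed.

Lemma dotDl u v w : dot (u + v) w = dot u w + dot v w.
Proof. by rewrite -big_split; apply: eq_bigr => i _; rewrite mxE mulrDl. Qed.

Lemma dotZl c u v : dot (c *: u) v = c * dot u v.
Proof. by rewrite mulr_sumr; apply: eq_bigr => i _; rewrite mxE mulrA. Qed.

Lemma dotNl u v : dot (- u) v = - dot u v.
Proof. by rewrite -scaleN1r dotZl mulN1r. Qed.

Lemma dotBl u v w : dot (u - v) w = dot u w - dot v w.
Proof. by rewrite dotDl dotNl. Qed.

Lemma dotDr u v w : dot u (v + w) = dot u v + dot u w.
Proof. by rewrite dotC dotDl ![dot _ u]dotC. Qed.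

Lemma dotZr c u v : dot u (c *: v) = c * dot u v.
Proof. by rewrite dotC dotZl dotC. Qed.

Lemma dotNr u v : dot u (- v) = - dot u v.
Proof. by rewrite dotC dotNl dotC. Qed.

Lemma dotBr u v w : dot u (v - w) = dot u v - dot u w.
Proof. by rewrite dotDr dotNr. Qed.

Lemma dot0l v : dot 0 v = 0.
Proof. by rewrite -(scale0r 0) dotZl mul0r. Qed.

Lemma dot0r v : dot v 0 = 0.
Proof. by rewrite dotC dot0l. Qed.

Lemma dot_ge0 u : 0 <= dot u u.
Proof. by apply: sumr_ge0 => i _; rewrite -expr2 sqr_ge0. Qed.

Lemma dot_eq0 u : dot u u = 0 -> u = 0.
Proof.
move=> u0; apply/rowP => i; rewrite mxE; apply/eqP; rewrite -sqrf_eq0 expr2.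
apply/eqP; move: u0; rewrite /dot => /psumr_eq0P; apply => // j _.
by rewrite -expr2 sqr_ge0.
Qed.

Lemma dot_subr_sqr u v : dot u u - dot v v = dot (u - v) (u - v + 2 *: v).
Proof.
have -> : u - v + 2 *: v = u + v by rewrite scaler_nat mulr2n addrA subrK.
rewrite dotBl !dotDr (dotC v u); ring.
Qed.

Lemma dot_mulmx u v : dot u v = (u *m v^T) 0 0.
Proof. by rewrite mxE; apply: eq_bigr => i _; rewrite mxE. Qed.

Lemma enorm_ge0 u : 0 <= enorm u.
Proof. exact: sqrtr_ge0. Qed.

Lemma sqr_enorm u : enorm u ^+ 2 = dot u u.
Proof. by rewrite sqr_sqrtr ?dot_ge0. Qed.

Lemma enorm0 : enorm (0 : 'rV[R]_k) = 0.
Proof. by rewrite /enorm dot0l sqrtr0. Qed.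

Lemma enorm_eq0 u : enorm u = 0 -> u = 0.
Proof. by move=> u0; apply: dot_eq0; rewrite -sqr_enorm u0 expr0n. Qed.

Lemma enorm_gt0 u : u != 0 -> 0 < enorm u.
Proof.
by move=> u0; rewrite lt_def enorm_ge0 andbT; apply: contra_neq u0 => /enorm_eq0.
Qed.

Lemma enormZ c u : enorm (c *: u) = `|c| * enorm u.
Proof. by rewrite /enorm dotZl dotZr mulrA -expr2 sqrtrM ?sqr_ge0 // sqrtr_sqr. Qed.

Lemma enormN u : enorm (- u) = enorm u.
Proof. by rewrite -scaleN1r enormZ normrN1 mul1r. Qed.

Lemma enormB u v : enorm (u - v) = enorm (v - u).
Proof. by rewrite -enormN opprB. Qed.

Lemma cauchy_schwarz u v : `|dot u v| <= enorm u * enorm v.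
Proof.
have [->|v0] := eqVneq v 0; first by rewrite dot0r normr0 enorm0 mulr0.
have v1 : 0 < dot v v by rewrite -sqr_enorm exprn_gt0 // enorm_gt0.
rewrite -ler_sqr ?nnegrE ?mulr_ge0 ?enorm_ge0 // exprMn !sqr_enorm.
rewrite real_normK ?num_real //.
have := dot_ge0 (dot v v *: u - dot u v *: v).
rewrite dotBl !dotBr !dotZl !dotZr (dotC v u) => h.
rewrite -(ler_pM2l v1) -subr_ge0.
by apply: le_trans h _; rewrite le_eqVlt; apply/orP; left; apply/eqP; ring.
Qed.

Lemma dot_le u v : dot u v <= enorm u * enorm v.
Proof. exact: le_trans (ler_norm _) (cauchy_schwarz u v). Qed.

Lemma ler_enormD u v : enorm (u + v) <= enorm u + enorm v.
Proof.
rewrite -ler_sqr ?nnegrE ?addr_ge0 ?enorm_ge0 //.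
rewrite sqr_enorm dotDl !dotDr sqrrD !sqr_enorm (dotC v u).
by have := dot_le u v; lra.
Qed.

Lemma ler_enormB u v : enorm (u - v) <= enorm u + enorm v.
Proof. by rewrite -(enormN v); exact: ler_enormD. Qed.

Lemma ler_norm_enorm u : `|u| <= enorm u.
Proof.
rewrite (_ : `|u| = mx_norm u) // /mx_norm.
apply: (big_ind (fun c : {nonneg R} => c%:num <= enorm u)) => /=.
- exact: enorm_ge0.
- by move=> a b ha hb; rewrite /= /Num.max; case: ifP.
move=> [i j] _ /=; rewrite (ord1 i) /enorm -sqrtr_sqr ler_sqrt ?dot_ge0 //.
rewrite /dot (bigD1 j) //= expr2 lerDl.
by apply: sumr_ge0 => l _; rewrite -expr2 sqr_ge0.
Qed.

Lemma ler_coord_norm u i : `|u 0 i| <= `|u|.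
Proof.
rewrite [`|u|](_ : _ = mx_norm u) // mx_normrE.
by apply: (le_trans _ (le_bigmax _ _ (0, i))).
Qed.

Lemma rV_norm_le u c : 0 <= c -> (forall i, `|u 0 i| <= c) -> `|u| <= c.
Proof.
move=> c0 uc; rewrite [`|u|](_ : _ = mx_norm u) // mx_normrE.
by apply: bigmax_le => // -[i j] _ /=; rewrite (ord1 i).
Qed.

Lemma ler_enorm_norm u : enorm u <= k%:R * `|u|.
Proof.
rewrite -ler_sqr ?nnegrE ?mulr_ge0 ?enorm_ge0 // sqr_enorm.
apply: (@le_trans _ _ (\sum_(i < k) `|u| ^+ 2)).
  apply: ler_sum => i _; rewrite -expr2 -real_normK ?num_real //.
  by rewrite ler_sqr ?nnegrE // ler_coord_norm.
rewrite sumr_const card_ord -[_ *+ k]mulr_natl exprMn; apply: ler_wpM2r; first exact: sqr_ge0.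
by rewrite -natrX ler_nat; case: k => // n; rewrite expnS leq_pmulr.
Qed.

End Dot.

Lemma enorm_mulmx_le (R : realType) (m k : nat) (J : 'M[R]_(m, k)) :
  exists2 C, 0 < C & forall a : 'rV[R]_m, enorm (a *m J) <= C * enorm a.
Proof.
exists (1 + \sum_i enorm (row i J)).
  by rewrite ltr_pwDl // sumr_ge0 // => i _; exact: enorm_ge0.
move=> a; rewrite mulmx_sum_row mulrDl mul1r mulr_suml.
apply: (@le_trans _ _ (\sum_i enorm (a 0 i *: row i J))).
  elim/big_ind2 : _ => [|x y u v h1 h2|//]; first by rewrite enorm0.
  exact: le_trans (ler_enormD _ _) (lerD h1 h2).
rewrite -[leLHS]add0r; apply: lerD; first exact: enorm_ge0.
apply: ler_sum => i _; rewrite enormZ mulrC; apply: ler_wpM2l; first exact: enorm_ge0.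
exact: le_trans (ler_coord_norm _ _) (ler_norm_enorm _).
Qed.

(** The normal equations a (J J^T) = v J^T are solvable because J J^T and J^T have the same
    row space: a vector u with u J J^T = 0 satisfies |u J|^2 = 0. *)
Lemma ex_row_space_projection (R : realType) (m k : nat) (J : 'M[R]_(m, k)) (v : 'rV[R]_k) :
  exists a : 'rV[R]_m, forall b : 'rV[R]_m, dot (v - a *m J) (b *m J) = 0.
Proof.
have JJ : (J^T <= J *m J^T)%MS.
  rewrite -(mxrank_leqif_sup (submxMl _ _)) eqn_leq mxrankS ?submxMl //=.
  have kerJ : (kermx (J *m J^T) <= kermx J)%MS.
    apply/sub_kermxP/row_matrixP => i; rewrite row_mul row0.
    apply: dot_eq0; rewrite dot_mulmx trmx_mul mulmxA -(mulmxA _ J) -row_mul mulmx_ker.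
    by rewrite row0 mul0mx mxE.
  have := mxrankS kerJ; rewrite !mxrank_ker mxrank_tr => h.
  rewrite leqNgt; apply/negP => lt_rank; move: h.
  by rewrite leqNgt ltn_sub2l // (leq_trans lt_rank) // rank_leq_row.
have /submxP[a aE] : (v *m J^T <= J *m J^T)%MS by exact: submx_trans (submxMl _ _) JJ.
exists a => b; rewrite dot_mulmx trmx_mul mulmxA mulmxBl aE mulmxA.
by rewrite subrr mul0mx mxE.
Qed.

(** * First-order expansions of maps with continuous derivatives *)

Lemma is_derive_line (R : realType) (V W : normedModType R) (f : V -> W) (p w : V) (t : R) :
  derivable f (t *: w + p) w ->
  is_derive t 1 (fun s => f (s *: w + p)) ('D_w f (t *: w + p)).
Proof.
have E : (fun h : R => h^-1 *: (((fun s => f (s *: w + p)) \o shift t) (h *: 1) - f (t *: w + p)))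
       = (fun h => h^-1 *: ((f \o shift (t *: w + p)) (h *: w) - f (t *: w + p))).
  by apply/funext => h /=; rewrite scalerDl addrA scaler1.
move=> df; split; first by rewrite /derivable E.
by rewrite /derive E.
Qed.

Lemma MVT_le (R : realType) (g dg : R -> R) (a b d : R) : a <= b ->
  (forall t : R, a <= t <= b -> is_derive t 1 g (dg t)) ->
  (forall t, a <= t <= b -> `|dg t| <= d) -> `|g b - g a| <= d * (b - a).
Proof.
move=> ab dgE dg_le.
have [t|t|c] := @MVT_segment _ g dg a b ab.
- by rewrite in_itv /= => /andP[t0 ts]; apply: dgE; rewrite !ltW.
- apply: derivable_within_continuous => x; rewrite in_itv /= => xab.
  by have dgx := dgE _ xab; exact: ex_derive.
rewrite in_itv /= => cab ->.
by rewrite normrM (ger0_norm (_ : 0 <= b - a)) ?subr_ge0 // ler_wpM2r ?subr_ge0 ?dg_le.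
Qed.

Lemma MVT_signed (R : realType) (g dg : R -> R) (s d : R) :
  (forall t : R, `|t| <= `|s| -> is_derive t 1 g (dg t)) ->
  (forall t, `|t| <= `|s| -> `|dg t| <= d) -> `|g s - g 0| <= d * `|s|.
Proof.
move=> dgE dg_le.
have [s0|/ltW s0] := leP 0 s.
  have h t : 0 <= t <= s -> `|t| <= `|s|.
    by move=> /andP[t0 ts]; rewrite !ger0_norm.
  rewrite (ger0_norm s0) -[X in d * X]subr0.
  by apply: (@MVT_le _ g dg) => // t /h; [exact: dgE|exact: dg_le].
have h t : s <= t <= 0 -> `|t| <= `|s|.
  by move=> /andP[t0 ts]; rewrite !ler0_norm // lerN2.
rewrite (ler0_norm s0) -[X in d * X]add0r distrC.
by apply: (@MVT_le _ g dg) => // t /h; [exact: dgE|exact: dg_le].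
Qed.

(** Continuity of each directional derivative is not uniform in the direction, so the mean
    value theorem on the segment from x to x + v does not suffice.  Moving one coordinate
    at a time uses only the m partial derivatives. *)
Lemma C1_expansion_scalar (R : realType) (m : nat) (U : set 'rV[R]_m) (f : 'rV[R]_m -> R)
    (x : 'rV[R]_m) :
  open U -> U x -> (forall y v, U y -> derivable f y v) ->
  (forall v, {for x, continuous (fun y => 'D_v f y)}) ->
  forall e : R, 0 < e -> \forall v \near (0 : 'rV[R]_m), U (x + v) /\
    `|f (x + v) - f x - \sum_i v 0 i * 'D_(delta_mx 0 i) f x| <= e * `|v|.
Proof.
move=> oU Ux df cdf e e0.
have e1 : 0 < e / m.+1%:R by rewrite divr_gt0.
have : \forall y \near x, U y /\ forall i : 'I_m,
    `|'D_(delta_mx 0 i) f x - 'D_(delta_mx 0 i) f y| <= e / m.+1%:R.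
  near=> y; split; near: y; first exact: open_nbhs_nbhs.
  apply: filter_forall => i.
  by apply: (@cvgr_dist_le _ _ _ _ _ (fun y => 'D_(delta_mx 0 i) f y)) => //; exact: cdf.
move=> /nbhs_ballP[r r0 Hr].
apply/nbhs_ballP; exists r => // v; rewrite -ball_normE /= sub0r normrN => vr.
have Br y : `|y| <= `|v| -> ball x r (x + y).
  move=> yv; rewrite -ball_normE /= opprD addrA subrr sub0r normrN.
  exact: le_lt_trans vr.
split; first by have [] := Hr _ (Br v (lexx _)).
pose p (j : nat) : 'rV[R]_m := \row_i (if (i < j)%N then v 0 i else 0).
have p_le j (i : 'I_m) t : `|t| <= `|v 0 i| -> i = j :> nat ->
    `|t *: delta_mx 0 i + p j| <= `|v|.
  move=> tv ij; apply: rV_norm_le => // h; rewrite !mxE eqxx /=.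
  have [->|hi] := eqVneq h i; first by rewrite ij ltnn mulr1 addr0 (le_trans tv) ?ler_coord_norm.
  rewrite mulr0 add0r; case: ifP => _; last by rewrite normr0.
  exact: ler_coord_norm.
(* Changing the i-th coordinate alone: the mean value inequality for f minus its linear part. *)
have step (i : 'I_m) : `|f (x + p i.+1) - f (x + p i) - v 0 i * 'D_(delta_mx 0 i) f x|
    <= e / m.+1%:R * `|v|.
  pose c := 'D_(delta_mx 0 i) f x.
  pose g s := f (s *: delta_mx 0 i + (x + p i)) - s * c.
  pose dg s := 'D_(delta_mx 0 i) f (s *: delta_mx 0 i + (x + p i)) - c.
  have Hs s : `|s| <= `|v 0 i| -> ball x r (s *: delta_mx 0 i + (x + p i)).
    by move=> sv; rewrite addrCA; apply/Br/p_le.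
  have pS : p i.+1 = v 0 i *: delta_mx 0 i + p i.
    apply/rowP => h; rewrite !mxE eqxx /= ltnS leq_eqVlt.
    have [->|hi] := eqVneq h i; first by rewrite eqxx ltnn mulr1 addr0.
    by rewrite mulr0 add0r (negbTE (_ : h != i :> nat)).
  have := @MVT_signed _ g dg (v 0 i) (e / m.+1%:R) _ _.
  rewrite /g mul0r scale0r add0r subr0 addrCA -pS addrAC => h.
  apply: (le_trans (h _ _)).
  - move=> t /Hs /Hr [Ut _]; have := @is_derive_line _ _ _ f (x + p i) (delta_mx 0 i) t (df _ _ Ut).
    move=> ?; apply: is_derive_eq.
    by rewrite /dg /GRing.scale /= mulr1 mulr0 add0r.
  - by move=> t /Hs /Hr [_ /(_ i)]; rewrite distrC.
  - by rewrite ler_wpM2l ?ler_coord_norm // ltW.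
have pm : p m = v by apply/rowP => i; rewrite mxE ltn_ord.
have p0 : p 0%N = 0 by apply/rowP => i; rewrite !mxE.
have -> : f (x + v) - f x = \sum_(i < m) (f (x + p i.+1) - f (x + p i)).
  rewrite -(big_mkord xpredT (fun i => f (x + p i.+1) - f (x + p i))).
  by rewrite telescope_sumr // pm p0 addr0.
rewrite -sumrB; apply: le_trans (ler_norm_sum _ _ _) _.
apply: le_trans (ler_sum _ (fun i _ => step i)) _.
rewrite sumr_const card_ord -mulrnAl -mulr_natr; apply: ler_wpM2r => //.
by rewrite mulrAC ler_pdivrMr // ler_wpM2l ?ler_nat // ltW.
Unshelve. all: by end_near.
Qed.

Lemma near0_add_open (R : realType) (m : nat) (U : set 'rV[R]_m) (x : 'rV[R]_m) :
  open U -> U x -> \forall v \near (0 : 'rV[R]_m), U (x + v).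
Proof.
move=> oU Ux; have /nbhs_ballP[r r0 rU] : nbhs x U by exact: open_nbhs_nbhs.
apply/nbhs_ballP; exists r => // v; rewrite -ball_normE /= sub0r normrN => vr.
by apply: rU; rewrite -ball_normE /= opprD addrA subrr sub0r normrN.
Qed.

Definition jacobian_row (R : realType) (m k : nat) (f : 'rV[R]_m -> 'rV[R]_k) (x : 'rV[R]_m) :
  'M[R]_(m, k) := \matrix_(i < m) 'D_(delta_mx 0 i) f x.

Lemma C1_expansion (R : realType) (m k : nat) (U : set 'rV[R]_m) (f : 'rV[R]_m -> 'rV[R]_k)
    (x : 'rV[R]_m) : open U -> U x -> Ck 1 U f ->
  forall e : R, 0 < e -> \forall v \near (0 : 'rV[R]_m), U (x + v) /\
    enorm (f (x + v) - f x - v *m jacobian_row f x) <= e * enorm v.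
Proof.
move=> oU Ux [df cdf] e e0.
have e1 : 0 < e / k.+1%:R by rewrite divr_gt0.
have dfj (j : 'I_k) y v : U y -> derivable (fun x => f x 0 j) y v.
  by move=> Uy; exact: (derivable_mxP _ _ _).1 (df _ _ Uy) 0 j.
have Df y v j : U y -> 'D_v f y 0 j = 'D_v (fun x => f x 0 j) y.
  by move=> Uy; rewrite derive_mx ?mxE //; exact: df.
have cdfj (j : 'I_k) v : {for x, continuous (fun y => 'D_v (fun x => f x 0 j) y)}.
  apply/(@cvgrPdist_le _ _ _ (nbhs x)) => d d0.
  have nU : \forall y \near x, U y by exact: open_nbhs_nbhs.
  have : \forall y \near x, `|'D_v f x - 'D_v f y| <= d.
    by move/(@cvgrPdist_le _ _ _ (nbhs x)): (cdf v _ Ux); exact.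
  apply: filterS2 nU => y Uy; apply: le_trans; rewrite -!Df //.
  by apply: le_trans (ler_coord_norm _ j); rewrite !mxE.
have : \forall v \near (0 : 'rV[R]_m), U (x + v) /\ forall j : 'I_k,
    U (x + v) /\ `|f (x + v) 0 j - f x 0 j - \sum_i v 0 i * 'D_(delta_mx 0 i) (fun x => f x 0 j) x|
      <= e / k.+1%:R * `|v|.
  near=> v; split; near: v.
    exact: near0_add_open.
  apply: filter_forall => j.
  by apply: (@C1_expansion_scalar _ _ U) => //; exact: dfj.
apply: filterS => v [Uxv h]; split=> //.
apply: le_trans (ler_enorm_norm _) _.
apply: (@le_trans _ _ (k%:R * (e / k.+1%:R * enorm v))).
  apply: ler_wpM2l => //; apply: rV_norm_le => [|j].
    by rewrite mulr_ge0 ?enorm_ge0 // ltW.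
  have [_] := h j; rewrite !mxE.
  under [X in _ -> `|_ - X| <= _]eq_bigr do rewrite mxE Df //.
  move=> /le_trans; apply; apply: ler_wpM2l; first exact: ltW.
  exact: ler_norm_enorm.
rewrite mulrA; apply: ler_wpM2r; first exact: enorm_ge0.
by rewrite mulrCA ler_piMr ?(ltW e0) // ler_pdivrMr // mul1r ler_nat.
Unshelve. all: by end_near.
Qed.

Lemma derive_jacobian (R : realType) (m k : nat) (U : set 'rV[R]_m) (f : 'rV[R]_m -> 'rV[R]_k)
    (x v : 'rV[R]_m) : open U -> U x -> Ck 1 U f -> 'D_v f x = v *m jacobian_row f x.
Proof.
move=> oU Ux Cf; apply: cvg_lim => //.
apply/cvgrPdist_le => e e0.
have e1 : 0 < e / (1 + enorm v) by rewrite divr_gt0 // ltr_pwDl // enorm_ge0.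
have := C1_expansion oU Ux Cf e1.
move=> /nbhs_ballP[r r0 Hr]; near=> h.
have h0 : h != 0 by near: h; exact: nbhs_dnbhs_neq.
have hr : `|h *: v| < r.
  rewrite normrZ; apply: (@le_lt_trans _ _ (`|h| * (1 + `|v|))).
    by rewrite ler_wpM2l // lerDr.
  rewrite -ltr_pdivlMr; last by rewrite ltr_pwDl.
  near: h; apply: dnbhs0_lt; rewrite divr_gt0 // ltr_pwDl //.
have [] := Hr (h *: v); first by rewrite -ball_normE /= sub0r normrN.
move=> _ /=; rewrite -scalemxAl enormZ => H.
apply: le_trans (ler_norm_enorm _) _; rewrite enormB.
have -> : h^-1 *: (f (h *: v + x) - f x) - v *m jacobian_row f x
    = h^-1 *: (f (x + h *: v) - f x - h *: (v *m jacobian_row f x)).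
  by rewrite [RHS]scalerBr scalerA mulVf // scale1r (addrC x).
rewrite enormZ normfV ler_pdivrMl ?normr_gt0 //.
apply: le_trans H _; rewrite mulrCA ler_wpM2l // mulrAC ler_pdivrMr ?ltr_pwDl ?enorm_ge0 //.
by rewrite ler_wpM2l ?(ltW e0) // lerDr.
Unshelve. all: by end_near.
Qed.

Lemma near0_enorm (R : realType) (m : nat) (P : 'rV[R]_m -> Prop) :
  (\forall v \near (0 : 'rV[R]_m), P v) -> exists2 r : R, 0 < r & forall v, enorm v < r -> P v.
Proof.
move=> /nbhs_ballP[r r0 Hr]; exists r => // v vr; apply: Hr.
by rewrite -ball_normE /= sub0r normrN (le_lt_trans (ler_norm_enorm _)).
Qed.

Lemma open_enorm (R : realType) (m : nat) (U : set 'rV[R]_m) (x : 'rV[R]_m) :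
  open U -> U x -> exists2 r : R, 0 < r & forall y, enorm (y - x) < r -> U y.
Proof.
move=> oU Ux; have [r r0 Hr] := near0_enorm (near0_add_open oU Ux).
by exists r => // y /Hr; rewrite subrKC.
Qed.

(** The form used from here on: explicit radii in the Euclidean norm. *)
Lemma C1_expansion_enorm (R : realType) (m k : nat) (U : set 'rV[R]_m) (f : 'rV[R]_m -> 'rV[R]_k)
    (x : 'rV[R]_m) : open U -> U x -> Ck 1 U f ->
  forall e : R, 0 < e -> exists2 r : R, 0 < r & forall v, enorm v < r -> U (x + v) /\
    enorm (f (x + v) - f x - 'D_v f x) <= e * enorm v.
Proof.
move=> oU Ux Cf e e0; have [r r0 Hr] := near0_enorm (C1_expansion oU Ux Cf e0).
by exists r => // v /Hr; rewrite (derive_jacobian v oU Ux Cf).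
Qed.

Lemma Ck_local (R : realType) (V W : normedModType R) (j : nat) (U : set V) (f : V -> W) :
  open U ->
  (forall x, U x -> exists (U' : set V) (F : V -> W),
    [/\ open U', U' x, Ck j U' F & forall y, U y -> U' y -> F y = f y]) ->
  Ck j U f.
Proof.
elim: j f => [|j IH] f oU Hf.
  move=> x Ux; have [U' [F [oU' U'x CF Ff]]] := Hf _ Ux.
  have nU : \forall y \near x, U y by exact: open_nbhs_nbhs.
  have nU' : \forall y \near x, U' y by exact: open_nbhs_nbhs.
  apply: (cvg_trans _ (_ : F @ x --> f x)).
    apply: near_eq_cvg; apply: filterS2 nU nU' => y Uy U'y; exact: Ff.
  by rewrite -Ff //; exact: CF.
have nearF x U' F : open U' -> U x -> U' x -> (forall y, U y -> U' y -> F y = f y) ->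
    \forall y \near x, F y = f y.
  move=> oU' Ux U'x Ff.
  have nU : \forall y \near x, U y by exact: open_nbhs_nbhs.
  have nU' : \forall y \near x, U' y by exact: open_nbhs_nbhs.
  by apply: filterS2 nU nU' => y Uy U'y; exact: Ff.
split.
  move=> x v Ux; have [U' [F [oU' U'x [dF _] Ff]]] := Hf _ Ux.
  by apply: near_eq_derivable (dF _ v U'x); exact: nearF Ff.
move=> v; apply: IH => // x Ux; have [U' [F [oU' U'x [dF CF] Ff]]] := Hf _ Ux.
exists U', (fun y => 'D_v F y); split; [exact: oU'|exact: U'x|exact: CF|].
move=> y Uy U'y; apply: near_eq_derive; exact: nearF Ff.
Qed.

Lemma smooth_on_open_Ck (R : realType) (V W : normedModType R) (j : nat) (U : set V) (f : V -> W) :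
  open U -> smooth_on U f -> Ck j U f.
Proof.
move=> oU sf; apply: Ck_local => // x /sf[U' [F [oU' U'x CF Ff]]].
by exists U', F; split.
Qed.

(** * Charts and tangent spaces *)

Section Chart.
Variables (R : realType) (k m : nat) (M : set 'rV[R]_k).
Variables (V : set 'rV[R]_m) (phi : 'rV[R]_m -> 'rV[R]_k) (x : 'rV[R]_m).
Hypotheses (chart : local_param M V phi) (Vx : V x).

Let oV : open V. Proof. by case: chart. Qed.

Lemma chart_Ck j : Ck j V phi.
Proof. by case: chart => _ [U _ [sphi _ _]]; exact: smooth_on_open_Ck. Qed.

Lemma chart_subset y : V y -> M (phi y).
Proof.
case: chart => _ [U _ [_ phiV _]] Vy.
by have [] : (M `&` U) (phi y) by rewrite -phiV; exists y.
Qed.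

Lemma chart_derive y a : V y -> 'D_a phi y = a *m jacobian_row phi y.
Proof. by move=> Vy; exact: (derive_jacobian a oV Vy (chart_Ck 1)). Qed.

(** A chart is a homeomorphism onto a neighbourhood in M of its image point, with an inverse
    that is Lipschitz at that point, being the restriction of a smooth map of the ambient
    space. *)
Lemma chart_inverse : exists C r : R, [/\ 0 < C, 0 < r &
  (forall y, V y -> enorm (phi y - phi x) < r -> enorm (y - x) <= C * enorm (phi y - phi x)) /\
  (forall q, M q -> enorm (q - phi x) < r -> exists2 y, V y & phi y = q)].
Proof.
have [_ [U oU [_ phiV [g sg gphi]]]] := chart.
have MUx : (M `&` U) (phi x) by rewrite -phiV; exists x.
have [W [G [oW Wp CG Gg]]] := sg _ MUx.
have [r1 r1_gt0 H1] := C1_expansion_enorm oW Wp (CG 1) ltr01.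
have [r2 r2_gt0 H2] := open_enorm oU MUx.2.
have [C C_gt0 HC] := enorm_mulmx_le (jacobian_row G (phi x)).
have GV y : V y -> enorm (phi y - phi x) < r1 -> G (phi y) = y.
  move=> Vy /H1; rewrite subrKC => -[Wy _].
  by rewrite Gg ?gphi // -phiV; exists y.
exists (1 + C), (Num.min r1 r2); split.
- by rewrite ltr_wpDl ?ltr01 // ltW.
- by rewrite lt_min r1_gt0.
split.
- move=> y Vy; rewrite lt_min => /andP[yr1 _].
  have [_] := H1 _ yr1; rewrite subrKC !GV // ?subrr ?enorm0 //.
  rewrite (derive_jacobian _ oW Wp (CG 1)) => h.
  have := ler_enormD (y - x - (phi y - phi x) *m jacobian_row G (phi x))
    ((phi y - phi x) *m jacobian_row G (phi x)).
  rewrite subrK => /le_trans; apply; rewrite mulrDl.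
  by apply: lerD; [exact: h|exact: HC].
- move=> q Mq; rewrite lt_min => /andP[_ /H2 Uq].
  by have [y Vy <-] : (phi @` V) q; [rewrite phiV|exists y].
Qed.

(** The differential inherits from the chart the lower bound of [chart_inverse], by applying
    the latter to x and x + h a for one small h. *)
Lemma chart_immersion : exists2 C : R, 0 < C &
  forall a, enorm a <= C * enorm ('D_a phi x).
Proof.
have [C [r [C0 r0 [HC _]]]] := chart_inverse.
have e0 : 0 < (2 * C)^-1 by rewrite invr_gt0 mulr_gt0.
have [r1 r1_gt0 H1] := C1_expansion_enorm oV Vx (chart_Ck 1) e0.
exists (2 * C); first by rewrite mulr_gt0.
move=> a.
have [->|a0] := eqVneq a 0; first by rewrite enorm0 mulr_ge0 ?enorm_ge0 // mulr_ge0 // ltW.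
have na : 0 < enorm a by exact: enorm_gt0.
have nD : 0 <= enorm ('D_a phi x) by exact: enorm_ge0.
(* h c dominates both |h a| and the increment of phi along h a. *)
pose c := 1 + enorm a + enorm ('D_a phi x) + (2 * C)^-1 * enorm a.
have c0 : 0 < c by rewrite /c; have := mulr_gt0 e0 na; lra.
pose h := Num.min r r1 / c / 2.
have h0 : 0 < h by rewrite !divr_gt0 // lt_min r0.
have hc : h * c < Num.min r r1.
  by rewrite /h mulrAC divfK ?gt_eqF // ltr_pdivrMr // ltr_pMr ?lt_min ?r0 // ltr1n.
have [hr hr1] : h * c < r /\ h * c < r1 by move: hc; rewrite lt_min => /andP[].
have ha : enorm (h *: a) = h * enorm a by rewrite enormZ gtr0_norm.
have [|Vh] := H1 (h *: a).
  rewrite ha (le_lt_trans _ hr1) // ler_wpM2l ?(ltW h0) // /c.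
  by have := mulr_gt0 e0 na; lra.
have -> : 'D_(h *: a) phi x = h *: 'D_a phi x by rewrite !chart_derive // scalemxAl.
rewrite ha => Hh.
have Hphi : enorm (phi (x + h *: a) - phi x) <= h * enorm ('D_a phi x) + (2 * C)^-1 * (h * enorm a).
  rewrite -[phi (x + _) - _](subrK (h *: 'D_a phi x)) addrC.
  rewrite addrC; apply: le_trans (ler_enormD _ _) _.
  by rewrite enormZ gtr0_norm // addrC lerD2l.
have := HC _ Vh; rewrite addrAC subrr add0r ha => Hy.
have : h * enorm a <= C * enorm (phi (x + h *: a) - phi x).
  apply: Hy; apply: le_lt_trans Hphi _; apply: le_lt_trans hr.
  rewrite mulrCA -mulrDr; apply: ler_wpM2l; first exact: ltW.
  by rewrite /c; lra.
move=> /le_trans /(_ (ler_wpM2l (ltW C0) Hphi)).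
rewrite mulrCA -mulrDr mulrCA ler_pM2l // mulrDr mulrA.
rewrite (_ : C * (2 * C)^-1 = 2^-1); last by rewrite invfM mulrCA mulfV ?gt_eqF // mulr1.
by lra.
Qed.

(** Secants of M through phi x become tangent: the normal component of q - phi x is of
    smaller order than q - phi x itself. *)
Lemma chart_secant e : 0 < e -> exists2 r : R, 0 < r & forall nu q,
  (forall a, dot nu ('D_a phi x) = 0) -> M q -> enorm (q - phi x) < r ->
  `|dot nu (q - phi x)| <= e * enorm nu * enorm (q - phi x).
Proof.
move=> e0; have [C [r [C0 r0 [HC HM]]]] := chart_inverse.
have [r1 r1_gt0 H1] := C1_expansion_enorm oV Vx (chart_Ck 1) (divr_gt0 e0 C0).
exists (Num.min r (r1 / C)); first by rewrite lt_min r0 divr_gt0.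
move=> nu q nu_perp Mq; rewrite lt_min => /andP[qr qr1].
have [y Vy yq] := HM _ Mq qr.
have yx : enorm (y - x) <= C * enorm (q - phi x) by rewrite -yq; apply: HC; rewrite ?yq.
have [|_] := H1 (y - x).
  by apply: le_lt_trans yx _; rewrite mulrC -ltr_pdivlMr.
rewrite subrKC yq => Hq.
rewrite -[q - phi x](subrK ('D_(y - x) phi x)) dotDr nu_perp addr0.
apply: le_trans (cauchy_schwarz _ _) _; rewrite subrK mulrAC mulrC.
rewrite ler_wpM2r ?enorm_ge0 //; apply: le_trans Hq _.
by rewrite mulrAC ler_pdivrMr // -mulrA ler_wpM2l ?(ltW e0) // mulrC.
Qed.

End Chart.

Lemma small_multiples_le (R : realType) (z b K : R) :
  (forall e, 0 < e -> e <= 1 -> z <= b + e * K) -> z <= b.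
Proof.
move=> H; rewrite leNgt; apply/negP => bz.
have K0 : 0 < K by have := H 1 ltr01 (lexx _); rewrite mul1r; lra.
have e0 : 0 < Num.min 1 ((z - b) / K / 2) by rewrite lt_min ltr01 !divr_gt0 // subr_gt0.
have := H _ e0; rewrite ge_min lexx => /(_ isT); apply/negP; rewrite -ltNge.
rewrite -ltrBrDl -ltr_pdivlMr // gt_min; apply/orP; right.
by rewrite ltr_pdivrMr // ltr_pMr ?divr_gt0 ?subr_gt0 // ltr1n.
Qed.

Lemma small_multiples_eq0 (R : realType) (z K : R) :
  (forall e, 0 < e -> e <= 1 -> `|z| <= e * K) -> z = 0.
Proof.
move=> H; apply/eqP; rewrite -normr_le0.
by apply: (@small_multiples_le _ _ _ K) => e e0 e1; rewrite add0r H.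
Qed.

(** w is a limit of secants (q - p) / h of M.  Tangent vectors of any chart and velocities of
    curves in M, at interior times, are of this kind, which makes it possible to compare
    them without composing charts. *)
Definition approached_along (R : realType) (k : nat) (M : set 'rV[R]_k) (p w : 'rV[R]_k) :=
  forall e d : R, 0 < e -> 0 < d -> exists h q,
    [/\ 0 < `|h|, `|h| < d, M q & enorm (q - p - h *: w) <= e * `|h|].

Lemma chart_approached_along (R : realType) (k m : nat) (M : set 'rV[R]_k) (V : set 'rV[R]_m)
    (phi : 'rV[R]_m -> 'rV[R]_k) (x a : 'rV[R]_m) :
  local_param M V phi -> V x -> approached_along M (phi x) ('D_a phi x).
Proof.
move=> chart Vx e d e0 d0; have [oV _] := chart.
have a1 : 0 < 1 + enorm a by rewrite ltr_pwDl // enorm_ge0.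
have [r r0 Hr] := C1_expansion_enorm oV Vx (chart_Ck chart 1) (divr_gt0 e0 a1).
pose h := Num.min d (r / (1 + enorm a)) / 2.
have h0 : 0 < h by rewrite divr_gt0 // lt_min d0 divr_gt0.
have : h < Num.min d (r / (1 + enorm a)).
  by rewrite ltr_pdivrMr // ltr_pMr ?ltr1n // lt_min d0 divr_gt0.
rewrite lt_min => /andP[hd hr].
have ha : enorm (h *: a) <= h * (1 + enorm a).
  by rewrite enormZ gtr0_norm // ler_wpM2l ?(ltW h0) // lerDr.
have [|Vh] := Hr (h *: a); first by rewrite (le_lt_trans ha) // -ltr_pdivlMr.
rewrite (chart_derive chart (h *: a) Vx) -scalemxAl -(chart_derive chart a Vx) => Hh.
exists h, (phi (x + h *: a)); rewrite gtr0_norm //; split=> //.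
  exact: (chart_subset chart).
apply: le_trans Hh _; apply: le_trans (ler_wpM2l (ltW (divr_gt0 e0 a1)) ha) _.
by rewrite mulrCA divfK ?gt_eqF // mulrC.
Qed.

Lemma chart_normal_approached (R : realType) (k m : nat) (M : set 'rV[R]_k) (V : set 'rV[R]_m)
    (phi : 'rV[R]_m -> 'rV[R]_k) (x : 'rV[R]_m) (nu w : 'rV[R]_k) :
  local_param M V phi -> V x -> (forall a, dot nu ('D_a phi x) = 0) ->
  approached_along M (phi x) w -> dot nu w = 0.
Proof.
move=> chart Vx nu_perp Mw.
have nw := enorm_ge0 w; have nnu := enorm_ge0 nu.
apply: (@small_multiples_eq0 _ _ (enorm nu * (enorm w + 2))) => e e0 e1.
have [r r0 Hr] := chart_secant chart Vx e0.
have w2 : 0 < enorm w + 2 by lra.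
have [h [q [h0 hd Mq Hq]]] := Mw e (r / (enorm w + 2)) e0 (divr_gt0 r0 w2).
have nqp : enorm (q - phi x) <= `|h| * (enorm w + 1).
  rewrite -[q - phi x](subrK (h *: w)); apply: le_trans (ler_enormD _ _) _.
  rewrite enormZ mulrDr mulr1 addrC lerD2l; apply: le_trans Hq _.
  by rewrite ler_piMl.
have qr : enorm (q - phi x) < r.
  apply: le_lt_trans nqp _; move: hd; rewrite ltr_pdivlMr //.
  by apply: le_lt_trans; rewrite ler_wpM2l // lerD2l ler1n.
have h1 := Hr nu q nu_perp Mq qr.
rewrite -(ler_pM2l h0) -normrM -dotZr.
rewrite (_ : h *: w = (q - phi x) - (q - phi x - h *: w)); last by rewrite opprB addrC subrK.
rewrite dotBr; apply: le_trans (ler_normB _ _) _.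
apply: (le_trans (lerD h1 (cauchy_schwarz _ _))).
have h2 := ler_wpM2l (mulr_ge0 (ltW e0) nnu) nqp.
have h3 := ler_wpM2l nnu Hq.
apply: le_trans (lerD h2 h3) _.
by rewrite le_eqVlt; apply/orP; left; apply/eqP; ring.
Qed.

(** w minus its projection on the range of the differential is normal, hence orthogonal to w
    by [chart_normal_approached], hence zero. *)
Lemma chart_approached_derive (R : realType) (k m : nat) (M : set 'rV[R]_k) (V : set 'rV[R]_m)
    (phi : 'rV[R]_m -> 'rV[R]_k) (x : 'rV[R]_m) (w : 'rV[R]_k) :
  local_param M V phi -> V x -> approached_along M (phi x) w -> exists a, w = 'D_a phi x.
Proof.
move=> chart Vx Mw.
have [a Ha] := ex_row_space_projection (jacobian_row phi x) w.
exists a; rewrite (chart_derive chart) //; apply/eqP; rewrite -subr_eq0; apply/eqP.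
have nu_perp b : dot (w - a *m jacobian_row phi x) ('D_b phi x) = 0.
  by rewrite (chart_derive chart).
apply: dot_eq0; rewrite dotBr Ha subr0.
exact: (chart_normal_approached chart Vx).
Qed.

(** The tangent space, defined through all charts, is the range of the differential of any
    one of them; in particular it is a linear subspace. *)
Lemma tangent_chart (R : realType) (k m : nat) (M : set 'rV[R]_k) (V : set 'rV[R]_m)
    (phi : 'rV[R]_m -> 'rV[R]_k) (x : 'rV[R]_m) (w : 'rV[R]_k) :
  local_param M V phi -> V x -> tangent m M (phi x) w <-> exists a, w = 'D_a phi x.
Proof.
move=> chart Vx; split=> [[V' [psi [y [b [chart' Vy psiy ->]]]]]|[a ->]]; last first.
  by exists V, phi, x, a.
apply: (chart_approached_derive chart Vx); rewrite -psiy.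
exact: chart_approached_along chart' Vy.
Qed.

Section Submanifold.
Variables (R : realType) (k m : nat) (M : set 'rV[R]_k).
Hypothesis subM : submanifold m M.

Lemma submanifold_chart p : M p -> exists V (phi : 'rV[R]_m -> 'rV[R]_k) x,
  [/\ local_param M V phi, V x & phi x = p].
Proof. by move=> /subM[V [phi [chart [x Vx phix]]]]; exists V, phi, x. Qed.

Lemma tangent_projection p v : M p ->
  exists2 w, tangent m M p w & orthogonal_to (v - w) (tangent m M p).
Proof.
move=> /submanifold_chart[V [phi [x [chart Vx <-]]]].
have [a Ha] := ex_row_space_projection (jacobian_row phi x) v.
exists (a *m jacobian_row phi x).
  by apply/(tangent_chart _ chart Vx); exists a; rewrite (chart_derive chart).
by move=> w /(tangent_chart _ chart Vx)[b ->]; rewrite (chart_derive chart).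
Qed.

Lemma tangent_approached p w : M p -> approached_along M p w -> tangent m M p w.
Proof.
move=> /submanifold_chart[V [phi [x [chart Vx <-]]]] Mw.
by apply/(tangent_chart _ chart Vx); exact: (chart_approached_derive chart Vx).
Qed.

Lemma submanifold_secant p e : M p -> 0 < e -> exists2 r : R, 0 < r & forall nu q,
  orthogonal_to nu (tangent m M p) -> M q -> enorm (q - p) < r ->
  `|dot nu (q - p)| <= e * enorm nu * enorm (q - p).
Proof.
move=> /submanifold_chart[V [phi [x [chart Vx <-]]]] e0.
have [r r0 Hr] := chart_secant chart Vx e0; exists r => // nu q nu_perp.
apply: Hr => a; apply: nu_perp; apply/(tangent_chart _ chart Vx).
by exists a.
Qed.

End Submanifold.

(** * The second fundamental form bounds the turning of tangent spaces *)

Lemma ex_enorm_radius (R : realType) (m n : nat) (P : 'I_n -> 'rV[R]_m -> Prop) :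
  (forall i, exists2 r : R, 0 < r & forall v, enorm v < r -> P i v) ->
  exists2 r : R, 0 < r & forall v, enorm v < r -> forall i, P i v.
Proof.
move=> HP; apply: near0_enorm; apply: (@filter_forall _ _ _ (nbhs (0 : 'rV[R]_m))) => i.
have [r r0 Hr] := HP i; have r1 : 0 < r / m.+1%:R by rewrite divr_gt0.
apply/nbhs_ballP; exists (r / m.+1%:R) => // v; rewrite -ball_normE /= sub0r normrN => vr.
apply: Hr; apply: le_lt_trans (ler_enorm_norm _) _.
move: vr; rewrite ltr_pdivlMr //; apply: le_lt_trans.
by rewrite mulrC ler_wpM2l // ler_nat.
Qed.

Section ChartHessian.
Variables (R : realType) (k m : nat) (M : set 'rV[R]_k).
Variables (V : set 'rV[R]_m) (phi : 'rV[R]_m -> 'rV[R]_k) (x : 'rV[R]_m).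
Hypotheses (chart : local_param M V phi) (Vx : V x).

Let oV : open V. Proof. by case: chart. Qed.

Let CD j a : Ck j V (fun y => 'D_a phi y).
Proof. by have [_] := chart_Ck chart j.+1; exact. Qed.

Lemma chart_derive_sum y a : V y -> 'D_a phi y = \sum_i a 0 i *: 'D_(delta_mx 0 i) phi y.
Proof.
move=> Vy; rewrite (chart_derive chart) // mulmx_sum_row.
by apply: eq_bigr => i _; rewrite rowK.
Qed.

Lemma chart_hessian_sum v a : 'D_v (fun y => 'D_a phi y) x =
  \sum_i a 0 i *: 'D_v (fun y => 'D_(delta_mx 0 i) phi y) x.
Proof.
have dD i : derivable (fun y => 'D_(delta_mx 0 i) phi y) x v.
  by have [+ _] := CD 1 (delta_mx 0 i); exact.
transitivity ('D_v (\sum_i (a 0 i \*: (fun y => 'D_(delta_mx 0 i) phi y))) x).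
  apply: near_eq_derive; have nV : \forall y \near x, V y by exact: open_nbhs_nbhs.
  apply: filterS nV => y Vy; rewrite chart_derive_sum // fct_sumE.
  by apply: eq_bigr.
rewrite derive_sum => [|i]; last exact: derivableZ.
by apply: eq_bigr => i _; rewrite deriveZ.
Qed.

Lemma chart_hessianZl c v a :
  'D_(c *: v) (fun y => 'D_a phi y) x = c *: 'D_v (fun y => 'D_a phi y) x.
Proof. by rewrite !(derive_jacobian _ oV Vx (CD 1 a)) scalemxAl. Qed.

Lemma chart_hessianZr c v a :
  'D_v (fun y => 'D_(c *: a) phi y) x = c *: 'D_v (fun y => 'D_a phi y) x.
Proof.
rewrite [LHS]chart_hessian_sum [X in _ = _ *: X]chart_hessian_sum scaler_sumr.
by apply: eq_bigr => i _; rewrite mxE scalerA.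
Qed.

(** Makes estimates that hold for the m coordinate directions uniform in the direction. *)
Lemma ler_enorm_lincomb (a : 'rV[R]_m) (f : 'I_m -> 'rV[R]_k) (B : R) :
  (forall i, enorm (f i) <= B) -> enorm (\sum_i a 0 i *: f i) <= m%:R * B * enorm a.
Proof.
move=> fB; apply: (@le_trans _ _ (\sum_(i < m) B * enorm a)).
  apply: (@le_trans _ _ (\sum_i enorm (a 0 i *: f i))).
    elim/big_ind2 : _ => [|p q u v h1 h2|//]; first by rewrite enorm0.
    exact: le_trans (ler_enormD _ _) (lerD h1 h2).
  apply: ler_sum => i _; rewrite enormZ mulrC.
  apply: ler_pM => //; first exact: enorm_ge0.
  exact: le_trans (ler_coord_norm _ _) (ler_norm_enorm _).
by rewrite sumr_const card_ord -[_ *+ m]mulr_natl mulrA.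
Qed.

Lemma chart_derive_continuous e : 0 < e -> exists2 r : R, 0 < r & forall v a,
  enorm v < r -> V (x + v) /\ enorm ('D_a phi (x + v) - 'D_a phi x) <= e * enorm a.
Proof.
move=> e0; have e1 : 0 < e / m.+1%:R by rewrite divr_gt0.
have [r0 r0_gt0 H0] := near0_enorm (near0_add_open oV Vx).
have [|r r_gt0 Hr] := @ex_enorm_radius R m m (fun i v =>
    enorm ('D_(delta_mx 0 i) phi (x + v) - 'D_(delta_mx 0 i) phi x) <= e / m.+1%:R).
  move=> i.
  have [C C0 HC] := enorm_mulmx_le (jacobian_row (fun y => 'D_(delta_mx 0 i) phi y) x).
  have [r1 r1_gt0 H1] := C1_expansion_enorm oV Vx (CD 1 (delta_mx 0 i)) ltr01.
  have C1 : 0 < C + 1 by lra.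
  exists (Num.min r1 (e / m.+1%:R / (C + 1))); first by rewrite lt_min r1_gt0 divr_gt0.
  move=> v; rewrite lt_min => /andP[vr1]; rewrite ltr_pdivlMr // => vC.
  have [_] := H1 v vr1; rewrite (derive_jacobian _ oV Vx (CD 1 _)) mul1r => Hv.
  rewrite -[X in enorm X](subrK (v *m jacobian_row (fun y => 'D_(delta_mx 0 i) phi y) x)).
  apply: le_trans (ler_enormD _ _) _; apply: le_trans (lerD Hv (HC v)) _.
  by apply: le_trans (ltW vC); rewrite mulrDr mulr1 addrC mulrC.
exists (Num.min r0 r); first by rewrite lt_min r0_gt0.
move=> v a; rewrite lt_min => /andP[/H0 Vv /Hr Hv]; split=> //.
rewrite !chart_derive_sum // -sumrB.
under eq_bigr do rewrite -scalerBr.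
apply: le_trans (ler_enorm_lincomb _ Hv) _; rewrite ler_wpM2r ?enorm_ge0 //.
by rewrite mulrCA ler_piMr ?(ltW e0) // ler_pdivrMr // mul1r ler_nat.
Qed.

Lemma chart_derive_expansion e : 0 < e -> exists2 r : R, 0 < r & forall v a,
  enorm v < r -> V (x + v) /\
  enorm ('D_a phi (x + v) - 'D_a phi x - 'D_v (fun y => 'D_a phi y) x) <= e * enorm v * enorm a.
Proof.
move=> e0; have e1 : 0 < e / m.+1%:R by rewrite divr_gt0.
have [r0 r0_gt0 H0] := near0_enorm (near0_add_open oV Vx).
have [|r r_gt0 Hr] := @ex_enorm_radius R m m (fun i v =>
    enorm ('D_(delta_mx 0 i) phi (x + v) - 'D_(delta_mx 0 i) phi x
      - 'D_v (fun y => 'D_(delta_mx 0 i) phi y) x) <= e / m.+1%:R * enorm v).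
  move=> i; have [r1 r1_gt0 H1] := C1_expansion_enorm oV Vx (CD 1 (delta_mx 0 i)) e1.
  by exists r1 => // v /H1 [].
exists (Num.min r0 r); first by rewrite lt_min r0_gt0.
move=> v a; rewrite lt_min => /andP[/H0 Vv /Hr Hv]; split=> //.
rewrite chart_hessian_sum !chart_derive_sum // -!sumrB.
under eq_bigr do rewrite -!scalerBr.
apply: le_trans (ler_enorm_lincomb _ Hv) _; rewrite ler_wpM2r ?enorm_ge0 //.
rewrite mulrA ler_wpM2r ?enorm_ge0 //.
by rewrite mulrCA ler_piMr ?(ltW e0) // ler_pdivrMr // mul1r ler_nat.
Qed.

(** The normal component of the Hessian is the second fundamental form.  The bound on the
    latter concerns directions whose images are unit vectors; it extends by homogeneity,
    and the degenerate cases are trivial because the differential is injective. *)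
Lemma chart_normal_hessian (A : R) nu v a : (sup_sff m M <= A%:E)%E ->
  orthogonal_to nu (tangent m M (phi x)) ->
  `|dot nu ('D_v (fun y => 'D_a phi y) x)| <=
    A * enorm nu * enorm ('D_v phi x) * enorm ('D_a phi x).
Proof.
move=> supA nu_perp.
have [C C0 HC] := chart_immersion chart Vx.
have [v0|v0] := eqVneq (enorm ('D_v phi x)) 0.
  have -> : v = 0.
    by apply: enorm_eq0; apply/eqP; rewrite eq_le enorm_ge0 andbT (le_trans (HC _)) // v0 mulr0.
  by rewrite !derive0 dot0r normr0 enorm0 mulr0 mul0r.
have [a0|a0] := eqVneq (enorm ('D_a phi x)) 0.
  have aE : a = 0 *: a.
    rewrite scale0r; apply: enorm_eq0; apply/eqP.
    by rewrite eq_le enorm_ge0 andbT (le_trans (HC _)) // a0 mulr0.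
  by rewrite {1}aE chart_hessianZr scale0r dot0r normr0 a0 mulr0.
have nv : 0 < enorm ('D_v phi x) by rewrite lt_def v0 enorm_ge0.
have na : 0 < enorm ('D_a phi x) by rewrite lt_def a0 enorm_ge0.
have unit u : 0 < enorm ('D_u phi x) -> enorm ('D_((enorm ('D_u phi x))^-1 *: u) phi x) = 1.
  move=> nu0; rewrite (chart_derive chart _ Vx) -scalemxAl -(chart_derive chart _ Vx).
  by rewrite enormZ gtr0_norm ?invr_gt0 // mulVf ?gt_eqF.
pose v' := (enorm ('D_v phi x))^-1 *: v.
pose a' := (enorm ('D_a phi x))^-1 *: a.
pose H := 'D_v' (fun y => 'D_a' phi y) x.
have sff_le : enorm (sff M phi v' a' x) <= A.
  rewrite -lee_fin; apply: le_trans supA; apply: ereal_sup_ubound.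
  by exists V, phi, x, v', a'; split=> //; exact: unit.
have nuH : dot nu H = dot nu (sff M phi v' a' x).
  rewrite /sff /= -/H dotBr; set P := oproj _ _.
  suff -> : dot nu P = 0 by rewrite subr0.
  apply: nu_perp; rewrite /P /oproj.
  pose Q := [set w | tangent m M (phi x) w /\ orthogonal_to (H - w) (tangent m M (phi x))].
  suff /getPex [] : exists w, Q w by [].
  have [b Hb] := ex_row_space_projection (jacobian_row phi x) H.
  exists (b *m jacobian_row phi x); split.
    by apply/(tangent_chart _ chart Vx); exists b; rewrite (chart_derive chart).
  by move=> w /(tangent_chart _ chart Vx)[c ->]; rewrite (chart_derive chart).
have : `|dot nu H| <= enorm nu * A.
  by rewrite nuH (le_trans (cauchy_schwarz _ _)) // ler_wpM2l ?enorm_ge0.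
rewrite /H /v' /a' chart_hessianZl chart_hessianZr !dotZr !normrM.
move: (dot nu _) (enorm ('D_v phi x)) (enorm ('D_a phi x)) nv na => z X Y X0 Y0.
rewrite [`|X^-1|]gtr0_norm ?invr_gt0 // [`|Y^-1|]gtr0_norm ?invr_gt0 //.
rewrite ler_pdivrMl // ler_pdivrMl // => /le_trans; apply.
by rewrite le_eqVlt; apply/orP; left; apply/eqP; ring.
Qed.

End ChartHessian.

(** c bounds the sine of the angle between the tangent spaces at p and q. *)
Definition tilt_le (R : realType) (k m : nat) (M : set 'rV[R]_k) (p q : 'rV[R]_k) (c : R) :=
  forall nu w, orthogonal_to nu (tangent m M p) -> tangent m M q w ->
  `|dot nu w| <= c * enorm nu * enorm w.

Section Tilt.
Variables (R : realType) (k m : nat) (M : set 'rV[R]_k).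
Hypothesis subM : submanifold m M.

Lemma tilt_le_weaken p q c d : c <= d -> tilt_le m M p q c -> tilt_le m M p q d.
Proof.
move=> cd H nu w hnu hw; apply: le_trans (H _ _ hnu hw) _.
by rewrite !ler_wpM2r ?enorm_ge0.
Qed.

(** Insert the orthogonal projection on the tangent space at q: the tangential part of w is
    seen by nu through the first tilt, the normal part is small by the second. *)
Lemma tilt_le_trans p q r c d : M q -> 0 <= c -> 0 <= d ->
  tilt_le m M p q c -> tilt_le m M q r d -> tilt_le m M p r (c + d).
Proof.
move=> Mq c0 d0 Hpq Hqr nu w hnu hw.
have [w1 Tw1 w1_perp] := tangent_projection subM w Mq.
have w1_le : enorm w1 <= enorm w.
  have [->|n1] := eqVneq w1 0; first by rewrite enorm0 enorm_ge0.
  rewrite -(ler_pM2l (enorm_gt0 n1)) -expr2 sqr_enorm.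
  have := w1_perp _ Tw1; rewrite dotBl => /eqP; rewrite subr_eq0 => /eqP <-.
  by rewrite mulrC dot_le.
have w2_le : enorm (w - w1) <= d * enorm w.
  have [->|n2] := eqVneq (w - w1) 0; first by rewrite enorm0 mulr_ge0 ?enorm_ge0.
  rewrite -(ler_pM2l (enorm_gt0 n2)) -expr2 sqr_enorm dotBr (w1_perp _ Tw1) subr0.
  apply: le_trans (ler_norm _) _; apply: le_trans (Hqr _ _ w1_perp hw) _.
  by rewrite mulrCA mulrA.
rewrite -[w in dot nu w](subrK w1) dotDr; apply: le_trans (ler_normD _ _) _.
have h1 := Hpq _ _ hnu Tw1; have h2 := cauchy_schwarz nu (w - w1).
have h3 := ler_wpM2l (enorm_ge0 nu) w2_le.
have h4 := ler_wpM2l (mulr_ge0 c0 (enorm_ge0 nu)) w1_le.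
apply: le_trans (lerD (le_trans h2 h3) h1) _.
rewrite (_ : (c + d) * _ * _ = c * enorm nu * enorm w + enorm nu * (d * enorm w)); last by ring.
by rewrite addrC lerD2r.
Qed.

(** For w = d phi_y(a) and nu normal at p = phi x, the pairing <nu, w> is, to first order in
    y - x, the pairing of nu with the Hessian of phi in the directions y - x and a, which is
    at most A |nu| |q - p| |w|.  All error terms are small multiples of the same product and
    fit into the gap between A and c. *)
Lemma tilt_le_local (A c : R) p : 0 <= A -> A < c -> (sup_sff m M <= A%:E)%E -> M p ->
  exists2 r : R, 0 < r & forall q, M q -> enorm (q - p) < r -> tilt_le m M p q (c * enorm (q - p)).
Proof.
move=> A0 Ac supA /(submanifold_chart subM)[V [phi [x [chart Vx <-]]]] {p}.
have [oV _] := chart.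
have [C [r [C0 r0 [HC HM]]]] := chart_inverse chart Vx.
have [D D0 HD] := chart_immersion chart Vx.
(* The choice of e for which all the error terms add up to at most c - A. *)
pose S := A * C + C * D + c * D.
have S0 : 0 < S.
  rewrite /S; have := mulr_ge0 A0 (ltW C0); have := mulr_gt0 C0 D0.
  by have := mulr_gt0 (le_lt_trans A0 Ac) D0; lra.
pose e := (c - A) / S.
have e0 : 0 < e by rewrite divr_gt0 // subr_gt0.
have eS : e * (A * C + C * D + c * D) = c - A by rewrite divfK // gt_eqF.
have [r1 r1_gt0 H1] := C1_expansion_enorm oV Vx (chart_Ck chart 1) e0.
have [r2 r2_gt0 H2] := chart_derive_continuous chart Vx e0.
have [r3 r3_gt0 H3] := chart_derive_expansion chart Vx e0.
exists (Num.min r (Num.min r1 (Num.min r2 r3) / C)).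
  by rewrite lt_min r0 divr_gt0 // !lt_min r1_gt0 r2_gt0.
move=> q Mq; rewrite lt_min ltr_pdivlMr // !lt_min => /andP[qr /and3P[qr1 qr2 qr3]].
have [y Vy yq] := HM _ Mq qr.
have yx : enorm (y - x) <= C * enorm (q - phi x) by rewrite -yq; apply: HC; rewrite ?yq.
rewrite mulrC in qr1 qr2 qr3.
move=> nu w nu_perp; rewrite -{1}yq => /(tangent_chart _ chart Vy)[a ->].
have [_] := H1 _ (le_lt_trans yx qr1).
have [_] := H2 _ a (le_lt_trans yx qr2).
have [_] := H3 _ a (le_lt_trans yx qr3).
rewrite subrKC yq => {H1 H2 H3} H3 H2 H1.
have Dv : enorm ('D_(y - x) phi x) <= (1 + e * C) * enorm (q - phi x).
  rewrite -['D_(y - x) phi x](subKr (q - phi x)).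
  apply: le_trans (ler_enormB _ _) _; rewrite mulrDl mul1r lerD2l.
  by apply: le_trans H1 _; rewrite -mulrA ler_wpM2l // ltW.
have aD := HD a.
have X_le : enorm ('D_a phi x) * (1 - e * D) <= enorm ('D_a phi y).
  rewrite mulrBr mulr1 lerBlDr -['D_a phi x](subKr ('D_a phi y)).
  apply: le_trans (ler_enormB _ _) _; rewrite lerD2l; apply: le_trans H2 _.
  by rewrite subKr mulrCA ler_wpM2l ?(ltW e0) // mulrC.
set H := 'D_(y - x) (fun z => 'D_a phi z) x in H3.
rewrite -[X in dot nu X](subrK ('D_a phi x)) dotDr.
rewrite -[X in dot nu X + _](subrK H) dotDr.
have -> : dot nu ('D_a phi x) = 0.
  by apply: nu_perp; apply/(tangent_chart _ chart Vx); exists a.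
rewrite addr0; apply: le_trans (ler_normD _ _) _.
have h1 : `|dot nu ('D_a phi y - 'D_a phi x - H)| <=
    enorm nu * (e * (C * enorm (q - phi x)) * (D * enorm ('D_a phi x))).
  apply: le_trans (cauchy_schwarz _ _) _; rewrite ler_wpM2l ?enorm_ge0 //.
  apply: le_trans H3 _; apply: ler_pM; [|exact: enorm_ge0| |exact: aD].
    exact: mulr_ge0 (ltW e0) (enorm_ge0 _).
  by rewrite ler_wpM2l // ltW.
have h2 : `|dot nu H| <= A * enorm nu * ((1 + e * C) * enorm (q - phi x)) * enorm ('D_a phi x).
  apply: le_trans (chart_normal_hessian chart Vx _ _ supA nu_perp) _.
  by rewrite ler_wpM2r ?enorm_ge0 // ler_wpM2l // mulr_ge0 ?enorm_ge0.
apply: le_trans (lerD h1 h2) _.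
have nn := enorm_ge0 nu; have nq := enorm_ge0 (q - phi x).
apply: le_trans (_ : (c * enorm (q - phi x) * enorm nu) * (enorm ('D_a phi x) * (1 - e * D)) <= _).
  rewrite le_eqVlt; apply/orP; left; apply/eqP.
  transitivity (enorm nu * enorm (q - phi x) * enorm ('D_a phi x) * (A + e * (A * C + C * D))).
    by ring.
  transitivity (enorm nu * enorm (q - phi x) * enorm ('D_a phi x) * (c - e * (c * D)));
    last by ring.
  by congr (_ * _); rewrite -[X in X - _](subrK A) -eS; ring.
rewrite ler_wpM2l // !mulr_ge0 // ltW //.
exact: le_lt_trans A0 Ac.
Qed.

(** Tangent vectors at q are limits of tangent vectors at nearby points, by continuity of
    the differential of a chart. *)
Lemma tilt_le_limit p q c : 0 <= c -> M q ->
  (forall r, 0 < r -> exists q', [/\ M q', enorm (q' - q) < r & tilt_le m M p q' c]) ->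
  tilt_le m M p q c.
Proof.
move=> c0 /(submanifold_chart subM)[V [phi [x [chart Vx <-]]]] {q} Hq nu w nu_perp.
move=> /(tangent_chart _ chart Vx)[a ->].
have [C [r [C0 r0 [HC HM]]]] := chart_inverse chart Vx.
apply: (@small_multiples_le _ _ _ (c * enorm nu * enorm a + enorm nu * enorm a)) => e e0 _.
have [r1 r1_gt0 H1] := chart_derive_continuous chart Vx e0.
have rr : 0 < Num.min r (r1 / C) by rewrite lt_min r0 divr_gt0.
have [q' [Mq' +]] := Hq _ rr; rewrite lt_min ltr_pdivlMr // => /andP[qr qr1] tilt.
have [y Vy yq] := HM _ Mq' qr.
have yx : enorm (y - x) <= C * enorm (q' - phi x) by rewrite -yq; apply: HC; rewrite ?yq.
rewrite mulrC in qr1.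
have [_] := H1 _ a (le_lt_trans yx qr1); rewrite subrKC => Hy.
have Ty : tangent m M q' ('D_a phi y).
  by rewrite -yq; apply/(tangent_chart _ chart Vy); exists a.
rewrite -[X in dot nu X](subKr ('D_a phi y)) dotBr.
apply: le_trans (ler_normB _ _) _.
have h1 := tilt _ _ nu_perp Ty.
have h2 := le_trans (cauchy_schwarz nu _) (ler_wpM2l (enorm_ge0 nu) Hy).
apply: le_trans (lerD h1 h2) _.
have h3 : enorm ('D_a phi y) <= enorm ('D_a phi x) + e * enorm a.
  rewrite -['D_a phi y](subrK ('D_a phi x)) addrC.
  by rewrite [X in enorm X]addrC; apply: le_trans (ler_enormD _ _) _; rewrite addrC lerD2l.
have h4 := ler_wpM2l (mulr_ge0 c0 (enorm_ge0 nu)) h3.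
apply: le_trans (lerD h4 (lexx _)) _.
by rewrite le_eqVlt; apply/orP; left; apply/eqP; ring.
Qed.

End Tilt.

(** * Normal deviation along a rectifiable curve *)

Lemma continuous_induction (R : realType) (P : R -> Prop) :
  P 0 ->
  (forall t, 0 < t -> t <= 1 -> (forall s, 0 <= s -> s < t -> P s) -> P t) ->
  (forall t, 0 <= t -> t < 1 -> P t ->
    exists2 d : R, 0 < d & forall s, t < s -> s < t + d -> s <= 1 -> P s) ->
  forall t, 0 <= t -> t <= 1 -> P t.
Proof.
move=> P0 Plim Pstep.
(* The supremum of S satisfies P by the limit step, and is 1 by the forward step. *)
pose S := [set t : R | t <= 1 /\ forall s, 0 <= s -> s <= t -> P s].
have S0 : S 0.
  by split; rewrite ?ler01 // => s s0 s0'; have -> : s = 0 by apply/eqP; rewrite eq_le s0 s0'.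
have supS : has_sup S by split; [exists 0|exists 1 => t []].
have sup1 : sup S <= 1 by apply: ge_sup; [exists 0|move=> t []].
have sup0 : 0 <= sup S by apply: sup_upper_bound.
have Pbelow s : 0 <= s -> s < sup S -> P s.
  move=> s0 /sup_gt -/(_ (ex_intro _ 0 S0))[t [_ Pt] st].
  exact: Pt s0 (ltW st).
have Psup : P (sup S).
  have [sup_eq0|sup_neq0] := eqVneq (sup S) 0; first by rewrite sup_eq0.
  by apply: Plim => //; rewrite lt_def sup_neq0.
have Ple s : 0 <= s -> s <= sup S -> P s.
  move=> s0; rewrite le_eqVlt => /orP[/eqP -> //|]; exact: Pbelow.
have [sup_lt1|sup_ge1] := ltP (sup S) 1; last first.
  by move=> t t0 t1; apply: Ple => //; exact: le_trans sup_ge1.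
have [d d0 Pd] := Pstep _ sup0 sup_lt1 Psup.
pose t := Num.min 1 (sup S + d / 2).
have : S t.
  split; first by rewrite ge_min lexx.
  move=> s s0; rewrite le_min => /andP[s1 sd].
  have [/Ple|supS_s] := leP s (sup S); first exact.
  by apply: Pd => //; apply: le_lt_trans sd _; rewrite ltrD2l ltr_pdivrMr // ltr_pMr // ltr1n.
move=> /(sup_upper_bound supS); rewrite leNgt => /negP[].
by rewrite lt_min sup_lt1 ltrDl divr_gt0.
Qed.

Section CurveInSubmanifold.
Variables (R : realType) (k m : nat) (M : set 'rV[R]_k).
Hypothesis subM : submanifold m M.
Variables (A c : R).
Hypotheses (A0 : 0 <= A) (Ac : A < c) (supA : (sup_sff m M <= A%:E)%E).
Variables (gam : R -> 'rV[R]_k) (len : R -> R) (C : R).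
Hypothesis gamM : forall t, 0 <= t -> t <= 1 -> M (gam t).
Hypothesis gam_lip : forall s t, 0 <= s -> s <= t -> t <= 1 ->
  enorm (gam t - gam s) <= C * (t - s).
Hypothesis gam_len : forall s t, 0 <= s -> s <= t -> t <= 1 ->
  enorm (gam t - gam s) <= len t - len s.

Let c0 : 0 < c. Proof. exact: le_lt_trans A0 Ac. Qed.

Let len_homo s t : 0 <= s -> s <= t -> t <= 1 -> len s <= len t.
Proof.
by move=> s0 st t1; rewrite -subr_ge0 (le_trans (enorm_ge0 _) (gam_len s0 st t1)).
Qed.

Let gam_near r : 0 < r -> exists2 d : R, 0 < d & forall s t, 0 <= s -> s <= t -> t <= 1 ->
  t < s + d -> enorm (gam t - gam s) < r.
Proof.
move=> r0; have C1 : 0 < `|C| + 1 by rewrite ltr_wpDl.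
exists (r / (`|C| + 1)); first by rewrite divr_gt0.
move=> s t s0 st t1; rewrite -ltrBlDl ltr_pdivlMr // => h.
apply: le_lt_trans (gam_lip s0 st t1) _; apply: le_lt_trans h.
rewrite mulrC; apply: ler_wpM2l; first by rewrite subr_ge0.
by rewrite (le_trans (ler_norm _)) // lerDl.
Qed.

(** The tilt with respect to the tangent space at gam 0 grows at most at the rate c times the
    length: locally by [tilt_le_local] and [tilt_le_trans], while [tilt_le_limit] passes to
    limits from the left. *)
Lemma tilt_le_curve t : 0 <= t -> t <= 1 ->
  tilt_le m M (gam 0) (gam t) (c * (len t - len 0)).
Proof.
apply: (@continuous_induction _ (fun t => tilt_le m M (gam 0) (gam t) (c * (len t - len 0)))).
- move=> nu w nu_perp Tw; rewrite nu_perp // normr0 subrr mulr0 !mul0r //.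
- move=> {}t t0 t1 H; apply: (tilt_le_limit subM).
  + by rewrite mulr_ge0 ?(ltW c0) // subr_ge0 len_homo // ltW.
  + by apply: gamM => //; exact: ltW.
  move=> r r0; have [d d0 Hd] := gam_near r0.
  pose s := Num.max 0 (t - d / 2).
  have s0 : 0 <= s by rewrite le_max lexx.
  have st : s < t by rewrite gt_max t0 ltrBlDr ltrDl divr_gt0.
  exists (gam s); split.
  + by apply: gamM => //; rewrite (le_trans (ltW st)).
  + rewrite enormB; apply: Hd; rewrite ?(ltW st) //.
    apply: (@lt_le_trans _ _ (t - d / 2 + d)); last by rewrite lerD2r le_max lexx orbT.
    lra.
  + apply: tilt_le_weaken (H _ s0 st); rewrite ler_wpM2l ?(ltW c0) // lerD2r.
    by rewrite len_homo // ltW.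
- move=> {}t t0 t1 H.
  have [r r0 Hr] := tilt_le_local subM A0 Ac supA (gamM t0 (ltW t1)).
  have [d d0 Hd] := gam_near r0.
  exists d => // s ts sd s1.
  have near_s : enorm (gam s - gam t) < r by apply: Hd => //; exact: ltW.
  have Ms : M (gam s) by apply: gamM => //; rewrite (le_trans t0) // ltW.
  have h := Hr _ Ms near_s.
  have h1 : 0 <= c * (len t - len 0).
    by rewrite mulr_ge0 ?(ltW c0) // subr_ge0 len_homo // ltW.
  have h2 : 0 <= c * enorm (gam s - gam t) by rewrite mulr_ge0 ?(ltW c0) ?enorm_ge0.
  apply: tilt_le_weaken (tilt_le_trans subM (gamM t0 (ltW t1)) h1 h2 H h).
  rewrite -mulrDr ler_wpM2l ?(ltW c0) //.
  by have := gam_len t0 (ltW ts) s1; lra.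
Qed.

(** By [tilt_le_curve] the tangential part of nu at gam t has norm at most c len |nu|, and
    the normal part contributes only to second order to an increment of gam.  So
    <nu, gam t - gam 0> grows at most at the rate c len |nu| times the length. *)
Lemma normal_deviation_curve nu : orthogonal_to nu (tangent m M (gam 0)) ->
  `|dot nu (gam 1 - gam 0)| <= c * (len 1 - len 0) ^+ 2 * enorm nu.
Proof.
move=> nu_perp.
have len01 : 0 <= len 1 - len 0 by rewrite subr_ge0 len_homo.
apply: (@small_multiples_le _ _ _ (enorm nu * (len 1 - len 0))) => e e0 _.
have nn := enorm_ge0 nu.
suff : `|dot nu (gam 1 - gam 0)| <=
    ((c * (len 1 - len 0) + e) * enorm nu) * (len 1 - len 0).
  by move=> /le_trans; apply; rewrite le_eqVlt; apply/orP; left; apply/eqP; ring.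
pose a := (c * (len 1 - len 0) + e) * enorm nu.
have a0 : 0 <= a by rewrite mulr_ge0 // addr_ge0 ?(ltW e0) // mulr_ge0 // ltW.
apply: (@continuous_induction _ (fun t => `|dot nu (gam t - gam 0)| <= a * (len t - len 0))) => //.
- by rewrite subrr dot0r normr0 subrr mulr0.
- move=> t t0 t1 H.
  apply: (@small_multiples_le _ _ _ (enorm nu)) => r r0 _.
  have [d d0 Hd] := gam_near r0.
  pose s := Num.max 0 (t - d / 2).
  have s0 : 0 <= s by rewrite le_max lexx.
  have st : s < t by rewrite gt_max t0 ltrBlDr ltrDl divr_gt0.
  have near_s : enorm (gam t - gam s) <= r.
    apply: ltW; apply: Hd; rewrite ?(ltW st) //.
    apply: (@lt_le_trans _ _ (t - d / 2 + d)); last by rewrite lerD2r le_max lexx orbT.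
    lra.
  rewrite -[gam t - gam 0](subrKA (gam s)) dotDr; apply: le_trans (ler_normD _ _) _.
  rewrite addrC; apply: lerD.
    apply: le_trans (H _ s0 st) _; rewrite ler_wpM2l // lerD2r.
    by rewrite len_homo // ltW.
  by apply: le_trans (cauchy_schwarz _ _) _; rewrite mulrC ler_wpM2r.
- move=> t t0 t1 H.
  have [r r0 Hr] := submanifold_secant subM (gamM t0 (ltW t1)) e0.
  have [d d0 Hd] := gam_near r0.
  exists d => // s ts sd s1.
  have near_s : enorm (gam s - gam t) < r by apply: Hd => //; exact: ltW.
  have Ms : M (gam s) by apply: gamM => //; rewrite (le_trans t0) // ltW.
  rewrite -[gam s - gam 0](subrKA (gam t)) dotDr; apply: le_trans (ler_normD _ _) _.
  have st_len := gam_len t0 (ltW ts) s1.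
  suff h : `|dot nu (gam s - gam t)| <= a * (len s - len t) by move: H h; lra.
  apply: (@le_trans _ _ (a * enorm (gam s - gam t))); last exact: ler_wpM2l.
  (* Split nu at gam t: the tangential part nu1 is small by the tilt, the normal part meets the
     increment only to second order. *)
  have [nu1 Tnu1 nu2_perp] := tangent_projection subM nu (gamM t0 (ltW t1)).
  have nu1_le : enorm nu1 <= c * (len 1 - len 0) * enorm nu.
    have [->|n1] := eqVneq nu1 0; first by rewrite enorm0 !mulr_ge0 // ltW.
    rewrite -(ler_pM2l (enorm_gt0 n1)) -expr2 sqr_enorm.
    have := nu2_perp _ Tnu1; rewrite dotBl => /eqP; rewrite subr_eq0 => /eqP <-.
    apply: le_trans (ler_norm _) _.
    apply: le_trans (tilt_le_curve t0 (ltW t1) nu_perp Tnu1) _.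
    rewrite mulrC ler_wpM2l ?enorm_ge0 // ler_wpM2r // ler_wpM2l ?(ltW c0) //.
    by rewrite lerD2r len_homo // ltW.
  have nu2_le : enorm (nu - nu1) <= enorm nu.
    have [->|n1] := eqVneq (nu - nu1) 0; first by rewrite enorm0.
    rewrite -(ler_pM2l (enorm_gt0 n1)) -expr2 sqr_enorm dotBr (nu2_perp _ Tnu1) subr0.
    exact: dot_le.
  rewrite -[X in dot X _](subrK nu1) dotDl; apply: le_trans (ler_normD _ _) _.
  have h1 := Hr _ _ nu2_perp Ms near_s.
  have h2 := le_trans (cauchy_schwarz nu1 _) (ler_wpM2r (enorm_ge0 (gam s - gam t)) nu1_le).
  have h3 := ler_wpM2r (enorm_ge0 (gam s - gam t)) (ler_wpM2l (ltW e0) nu2_le).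
  apply: le_trans (lerD (le_trans h1 h3) h2) _.
  by rewrite le_eqVlt; apply/orP; left; apply/eqP; rewrite /a; ring.
Qed.

End CurveInSubmanifold.

(** * Lipschitz functions are integrals of their derivatives *)

Lemma le_integral_dominated d (T : measurableType d) (R : realType)
    (mu : {measure set T -> \bar R}) (D E : set T) (f g : T -> \bar R) :
  (forall x, D x -> (0 <= f x)%E) -> (forall x, E x -> (0 <= g x)%E) ->
  (forall x, (f \_ D) x <= (g \_ E) x)%E ->
  (\int[mu]_(x in D) f x <= \int[mu]_(x in E) g x)%E.
Proof.
move=> f0 g0 fg; rewrite !ge0_integralE//.
apply: ge_ereal_sup => _ [h hf <-]; apply: ereal_sup_ubound.
by exists h => // x; exact: le_trans (fg x).
Qed.

(** A simple function below f is almost everywhere below g, and g restricted to a set of full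
    measure is below f.  This is what allows integrals of [cderiv], a limit with an arbitrary
    value where it fails to exist, to be computed. *)
Lemma ge0_ae_eq_integral_rep d (T : measurableType d) (R : realType)
    (mu : {measure set T -> \bar R}) (D : set T) (f g : T -> \bar R) :
  measurable D -> measurable_fun D g ->
  (forall x, D x -> (0 <= f x)%E) -> (forall x, D x -> (0 <= g x)%E) ->
  {ae mu, forall x, D x -> f x = g x :> \bar R} ->
  (\int[mu]_(x in D) f x = \int[mu]_(x in D) g x)%E.
Proof.
move=> mD mg f0 g0 [N [mN N0 Nfg]].
have fgN x : D x -> ~ N x -> f x = g x :> \bar R.
  by move=> Dx Nx; apply: contrapT => fgx; apply: Nx; apply: Nfg => /(_ Dx).
apply/eqP; rewrite eq_le; apply/andP; split; last first.
  rewrite (ge0_negligible_integral mN)//; apply: le_integral_dominated => //.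
    by move=> x [Dx _]; exact: g0.
  move=> x; rewrite !patchE; case: ifPn => [|_].
    rewrite inE => -[Dx Nx]; rewrite (mem_set Dx).
    by rewrite (fgN _ Dx Nx).
  by case: ifPn => // /set_mem /f0.
have mgD : measurable_fun setT (g \_ D).
  exact/(measurable_restrictT _ _).1.
rewrite [leRHS]integral_mkcond ge0_integralE//; apply: ge_ereal_sup => _ [h hf <-].
rewrite -integralT_nnsfun.
apply: ae_ge0_le_integral => //.
- by move=> x _; rewrite lee_fin fun_ge0.
- exact/measurable_EFinP.

- by move=> x _; rewrite patchE; case: ifPn => // /set_mem /g0.
- exists N; split=> // x /= => hg; apply: contrapT => Nx; apply: hg => _.
  apply: le_trans (hf x) _; rewrite !patchE; case: ifPn => // /set_mem Dx.
  by rewrite (fgN _ Dx Nx).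
Qed.

Lemma itv_bounded_integrable (R : realType) (x y : bool) (a b B : R) (f : R -> R) :
  measurable_fun setT f -> (forall t, `|f t| <= B) ->
  (@lebesgue_measure R).-integrable [set` Interval (BSide x a) (BSide y b)] (EFin \o f).
Proof.
move=> mf fB; apply: measurable_bounded_integrable => //.
- have := @lebesgue_measure_itv R (Interval (BSide x a) (BSide y b)).
  by move=> /= ->; case: ifP; rewrite ?ltry // -EFinD ltry.
- exact: measurable_funTS.
- exists B; split; first exact: num_real.
  by move=> z Bz t _ /=; exact: le_trans (fB t) (ltW Bz).
Qed.

Lemma Rintegral_itv_cst (R : realType) (x y : bool) (a b c : R) : a <= b ->
  \int[@lebesgue_measure R]_(_ in [set` Interval (BSide x a) (BSide y b)]) c
  = c * (b - a).
Proof.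
move=> ab; rewrite Rintegral_cst //; congr (_ * _).
have := @lebesgue_measure_itv R (Interval (BSide x a) (BSide y b)).
move=> /= ->; rewrite lte_fin -EFinD.
have [//|leba] := ltP a b.
by have -> : b = a; [apply/eqP; rewrite eq_le leba ab|rewrite subrr].
Qed.

Lemma ae_neq (R : realType) (c : R) : {ae @lebesgue_measure R, forall t, t != c}.
Proof.
exists [set c]; split; [exact: measurable_set1|exact: lebesgue_measure_set1|].
by move=> t /= /negP; rewrite negbK => /eqP.
Qed.

Lemma clampP (R : realType) (l : R) : 0 < l -> exists c : R -> R,
  [/\ forall x, 0 <= c x <= l, forall x, 0 <= x -> x <= l -> c x = x,
      {homo c : x y / x <= y} & forall x y, `|c x - c y| <= `|x - y| ].
Proof.
move=> l0; exists (fun x => Num.max 0 (Num.min x l)); split.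
- move=> x; rewrite le_max lexx /= ge_max (ltW l0) /= ge_min lexx orbT //.
- by move=> x x0 xl; rewrite (min_idPl xl) (max_idPr x0).
- by move=> x y xy; apply: le_max2 => //; apply: le_min2.
- move=> x y; rewrite /Num.max /Num.min.
  have := ler_norm (x - y); have := ler_norm (y - x); rewrite (distrC y x).
  by case: (ltrP x l) => ?; case: (ltrP y l) => ?; case: (ltrP 0 x) => ?;
    case: (ltrP 0 y) => ?; rewrite ?l0 real_ler_norml ?num_real //; lra.
Qed.

Lemma lebesgue_stieltjes_measure_itv (R : realType) (F : cumulative R R) (a b : R) :
  a <= b -> lebesgue_stieltjes_measure F `]a, b]%classic = (F b - F a)%:E.
Proof.
move=> ab; rewrite /lebesgue_stieltjes_measure /measure_extension.
by rewrite measurable_mu_extE/=; [rewrite wlength_itv_bnd|exact: is_ocitv].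
Qed.

(** Both measures are infima over the same coverings by half-open intervals, on which the
    inequality is the hypothesis. *)
Lemma lebesgue_stieltjes_measure_lipschitz (R : realType) (F : cumulative R R) (C : R) :
  0 < C -> (forall x y, x <= y -> F y - F x <= C * (y - x)) ->
  forall A : set R, (lebesgue_stieltjes_measure F A <= C%:E * lebesgue_measure A)%E.
Proof.
move=> C0 lipF A.
rewrite -lee_pdivrMl //; apply: le_ereal_inf_tmp => _ [B [mB AB] <-].
rewrite lee_pdivrMl // -nneseriesZl => [|k _]; last first.
  exact: measure_ge0.
apply: (@le_trans _ _ (\sum_(0 <= k <oo) wlength F (B k))%E).
  by apply: ereal_inf_lbound; exists B.
apply: lee_nneseries => [k _ _|k _]; first exact: wlength_ge0.
have {mB AB} [[a b] _ /= BE] := mB k; rewrite -BE.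
have [ab|ba] := leP a b; last first.
  have -> : `]a, b]%classic = `]a, a]%classic :> set R.
    by rewrite !set_itv_ge // bnd_simp -leNgt // ltW.
  by rewrite !wlength_itv_bnd // !subrr mule0.
rewrite !wlength_itv_bnd // -EFinM lee_fin.
exact: lipF.
Qed.

(** F = f + D id, extended by constants outside [0, l], is nondecreasing for D >= |C| and
    generates a measure that is absolutely continuous by
    [lebesgue_stieltjes_measure_lipschitz].  Its Radon-Nikodym density g1 is almost
    everywhere the derivative of F, and g1 - D that of f.  Truncating the latter at |C|
    changes it within [0, l] on a null set only, and gives an everywhere bounded integrand. *)
Lemma lipschitz_FTC (R : realType) (l C : R) (f : R -> R) :
  0 < l -> (forall x y, 0 <= x <= l -> 0 <= y <= l -> `|f x - f y| <= C * `|x - y|) ->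
  exists g : R -> R, [/\ measurable_fun setT g, forall t, `|g t| <= `|C|,
    {ae @lebesgue_measure R, forall t, 0 < t < l -> is_derive t 1 f (g t)} &
    forall a b, 0 <= a -> a <= b -> b <= l ->
      f b - f a = \int[@lebesgue_measure R]_(t in `]a, b]) g t].
Proof.
move=> l0 lipf.
have [c [c_itv c_id c_homo c_lip]] := clampP l0.
(* The summand 1 makes the Lipschitz constant 2 D of F positive. *)
pose D := `|C| + 1.
have D0 : 0 < D by rewrite /D; have := normr_ge0 C; lra.
have lipf' x y : 0 <= x <= l -> 0 <= y <= l -> `|f x - f y| <= D * `|x - y|.
  move=> xl yl; apply: le_trans (lipf _ _ xl yl) _; apply: ler_wpM2r => //.
  by rewrite /D; have := ler_norm C; lra.
pose F x := f (c x) + D * c x.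
have FB x y : x <= y -> 0 <= F y - F x <= (2 * D) * (y - x).
  move=> xy; have := lipf' _ _ (c_itv y) (c_itv x).
  rewrite /F [`|c y - _|]ger0_norm ?subr_ge0 ?c_homo // ler_norml => /andP[h1 h2].
  have : c y - c x <= y - x.
    have := c_lip y x; rewrite !ger0_norm ?subr_ge0 ?c_homo //.
  move: (c_homo _ _ xy) => h3 h4.
  have h5 : D * (c y - c x) <= D * (y - x) by apply: ler_wpM2l => //; exact: ltW.
  apply/andP; split; first lra.
  lra.
have ndF : {homo F : x y / x <= y}.
  by move=> x y /FB /andP[+ _]; rewrite subr_ge0.
have rcF : right_continuous F.
  apply: right_continuousW => x; apply/cvgrPdist_le => e e0; near=> y.
  have : `|x - y| <= e / (2 * D).
    near: y; apply: (@cvgr_dist_le _ _ _ _ _ id) => //.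
    by rewrite divr_gt0 // mulr_gt0.
  rewrite ler_pdivlMr ?mulr_gt0 // => xy; apply: le_trans xy; rewrite mulrC.
  have [xley|/ltW ylex] := leP x y.
    have /andP[h1 h2] := FB _ _ xley.
    by rewrite distrC [`|x - y|]distrC !ger0_norm // subr_ge0.
  have /andP[h1 h2] := FB _ _ ylex.
  by rewrite !ger0_norm // subr_ge0.
pose Fc : cumulative R R := HB.pack F (isCumulative.Build R _ R F ndF rcF).
pose mu : {sigma_finite_measure set (measurableTypeR R) -> \bar R} := @lebesgue_measure R.
pose E : set (measurableTypeR R) := `]0, l]%classic.
have mE : measurable E by exact: measurable_itv.
have Fitv a b : a <= b -> lebesgue_stieltjes_measure Fc `]a, b]%classic = (F b - F a)%:E.
  by move=> ab; rewrite lebesgue_stieltjes_measure_itv.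
have Foo : (lebesgue_stieltjes_measure Fc E < +oo)%E.
  by rewrite Fitv ?ltry // ltW.
(* Radon-Nikodym requires a finite measure, hence the restriction to ]0, l]. *)
pose nu : {finite_measure set (measurableTypeR R) -> \bar R} := mfrestr mE Foo.
have numu : nu `<< mu.
  apply/null_content_dominatesP => A mA A0; apply/eqP; rewrite eq_le measure_ge0 andbT.
  rewrite /nu /= /mfrestr /mrestr.
  apply: (@le_trans _ _ (lebesgue_stieltjes_measure Fc A)).
    by apply: le_measure; rewrite ?inE //; exact: measurableI.
  apply: le_trans (@lebesgue_stieltjes_measure_lipschitz R Fc (2 * D) _ _ A) _.
  - by rewrite mulr_gt0.
  - by move=> x y /FB /andP[].
  - by rewrite [lebesgue_measure A]A0 mule0.
have [g0 [g0_ge0 g0_fin g0_int nuE]] := radon_nikodym_sigma_finite numu.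
pose g1 := fine \o g0.
have g1E : EFin \o g1 = g0 by apply/funext => x /=; rewrite fineK.
have g1_int : mu.-integrable setT (EFin \o g1) by rewrite g1E.
have g1_loc : locally_integrable [set: R] g1.
  exact: (open_integrable_locally openT g1_int).
have g1_intE y : (@lebesgue_measure R).-integrable
    [set` Interval (BRight 0) (BRight y)] (EFin \o g1).
  by apply: (integrableS measurableT _ _ g1_int).
have := FTC1 g1_intE g1_loc.
set G := fun x : R => _ => dG.
have GE x : 0 <= x -> x <= l -> G x = F x - F 0.
  move=> x0 xl; rewrite /G /Rintegral.
  have nuE0 : nu `]0, x]%classic = (F x - F 0)%:E.
    rewrite /nu /= /mfrestr /mrestr setIidl; first exact: Fitv.
    by apply: subset_itvl; rewrite bnd_simp.
  rewrite -[RHS]/(fine (F x - F 0)%:E) -nuE0 nuE //; congr fine; apply: eq_integral => y _.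
  by rewrite -g1E.
have dg1 : {ae mu, forall t, 0 < t < l -> is_derive t 1 f (g1 t - D)}.
  move: dG; apply: filterS; first exact: (ae_filter_ringOfSetsType mu).
  move=> t Gt /andP[t0 tl].
  have {Gt} [] := Gt _; first by rewrite /= lte_fin.
  rewrite derive1E => dGt DGt.
  have {dGt DGt} dGt : is_derive t 1 G (g1 t) by rewrite -DGt; exact: DeriveDef.
  have : is_derive t 1 (fun x => G x + F 0 - D * x) (g1 t - D).
    by apply: is_derive_eq; rewrite addr0 /GRing.scale /= mulr1.
  apply: near_eq_is_derive; rewrite ?oner_eq0 //.
  near=> x.
  have x0 : 0 < x by near: x; exact: lt_nbhsr.
  have xl : x < l by near: x; exact: lt_nbhsl.
  by rewrite GE ?(ltW x0) ?(ltW xl) // /F c_id ?(ltW x0) ?(ltW xl) //; ring.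
pose B := `|C|.
have B0 : 0 <= B by exact: normr_ge0.
have der_le t d : 0 < t < l -> is_derive t 1 f d -> `|d| <= B.
  move=> /andP[t0 tl] dft; have <- : 'D_1 f t = d by rewrite derive_val.
  have /cvg_norm cvg_d : h^-1 *: ((f \o shift t) (h *: 1) - f t) @[h --> (0:R)^'] --> 'D_1 f t.
    exact: ex_derive.
  rewrite /derive -(cvg_lim _ cvg_d) //; apply: limr_le; first exact: cvgP cvg_d.
  near=> h.
  have h0 : h != 0 by near: h; exact: nbhs_dnbhs_neq.
  have [ht0 htl] : 0 < h + t /\ h + t < l.
    split.
      by rewrite -ltrBlDr sub0r; near: h; apply: nbhs_dnbhs; apply: lt_nbhsr; rewrite oppr_lt0.
    by rewrite -ltrBrDr; near: h; apply: nbhs_dnbhs; apply: lt_nbhsl; rewrite subr_gt0.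
  rewrite normrZ normfV ler_pdivrMl ?normr_gt0 //= scaler1.
  have := lipf (h + t) t; rewrite (ltW t0) (ltW tl) (ltW ht0) (ltW htl) addrK.
  move=> /(_ isT isT) /le_trans; apply; rewrite mulrC; apply: ler_wpM2l => //.
  exact: ler_norm.
pose g t := Num.max (- B) (Num.min B (g1 t - D)).
have g_le t : `|g t| <= B.
  rewrite /g ler_norml le_max lexx /= ge_max ge_min lexx andbT /=; lra.
have gE t : `|g1 t - D| <= B -> g t = g1 t - D.
  rewrite ler_norml => /andP[h1 h2].
  by rewrite /g (min_idPr h2) (max_idPr h1).
have dg : {ae mu, forall t, 0 < t < l -> g t = g1 t - D /\ is_derive t 1 f (g t)}.
  move: dg1; apply: filterS; first exact: (ae_filter_ringOfSetsType mu).
  move=> t dt tl; have := dt tl => {}dt.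
  have gt := gE _ (der_le _ _ tl dt).
  by split => //; rewrite gt.
have mg1 : measurable_fun setT g1.
  by have [] := g1_loc.
exists g; split.
- apply: measurable_maxr => //; apply: measurable_minr => //.
  exact: measurable_funB.
- exact: g_le.
- move: dg; apply: filterS; first exact: (ae_filter_ringOfSetsType mu).
  by move=> t /[apply] -[].
move=> a b a0 ab bl.
have subE : `]a, b]%classic `<=` (setT : set R) by [].
have mab : measurable (`]a, b]%classic : set R) by exact: measurable_itv.
have g1ab : (@lebesgue_measure R).-integrable `]a, b]%classic (EFin \o g1).
  by apply: (integrableS measurableT _ _ g1_int).
have Dab : (@lebesgue_measure R).-integrable `]a, b]%classic (EFin \o (cst D)).
  by apply: (@itv_bounded_integrable _ _ _ _ _ D) => // t; rewrite /= gtr0_norm.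
have <- : \int[@lebesgue_measure R]_(t in `]a, b]) (g1 t - D) = f b - f a.
  rewrite RintegralB // Rintegral_itv_cst //.
  have -> : \int[lebesgue_measure]_(t in `]a, b]) g1 t = F b - F a.
    have nuab : nu `]a, b]%classic = (F b - F a)%:E.
      rewrite /nu /= /mfrestr /mrestr setIidl; first exact: Fitv.
      by apply: subset_itv; rewrite bnd_simp.
    rewrite -[RHS]/(fine (F b - F a)%:E) -nuab nuE //; congr fine.
    by apply: eq_integral => y _; rewrite -g1E.
  rewrite /F !c_id ?(le_trans a0 ab) ?(le_trans ab bl) //; ring.
congr fine; apply: ae_eq_integral => //.
- apply/measurable_EFinP; apply: measurable_funTS; exact: measurable_funB.
- apply/measurable_EFinP; apply: measurable_funTS.
  apply: measurable_maxr => //; apply: measurable_minr => //.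
  exact: measurable_funB.
move: (ae_neq l) dg; apply: filterS2; first exact: (ae_filter_ringOfSetsType mu).
move=> t tl dgt /=; rewrite in_itv /= => /andP[ta tb].
have [|-> //] := dgt _.
by rewrite (le_lt_trans a0 ta) lt_neqAle tl (le_trans tb bl).
Unshelve. all: by end_near.
Qed.

(** * Lipschitz curves and their lengths *)

Lemma is_derive_expansion (R : realType) (k : nat) (f : R -> 'rV[R]_k) (t : R) (d : 'rV[R]_k) :
  is_derive t 1 f d -> forall e : R, 0 < e ->
  exists2 r : R, 0 < r & forall s, `|s - t| < r ->
    enorm (f s - f t - (s - t) *: d) <= e * `|s - t|.
Proof.
move=> df e e0; have e1 : 0 < e / k.+1%:R by rewrite divr_gt0.
have cvg_d : h^-1 *: ((f \o shift t) (h *: 1) - f t) @[h --> (0:R)^'] --> d.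
  by rewrite -[d](@derive_val _ _ _ _ _ _ _ df); exact: ex_derive.
have [r r0 Hr] := (@cvgrPdist_le _ _ _ _ _ _ _).1 cvg_d _ e1.
exists r => // s st.
have [->|sneqt] := eqVneq s t; first by rewrite !subrr scale0r subrr enorm0 normr0 mulr0.
have st0 : s - t != 0 by rewrite subr_eq0.
have := Hr (s - t); rewrite /ball_ /= sub0r normrN => /(_ st st0).
rewrite scaler1 subrK => h.
rewrite (_ : f s - _ - _ = (s - t) *: ((s - t)^-1 *: (f s - f t) - d)); last first.
  by rewrite scalerBr scalerA mulfV // scale1r.
rewrite enormZ mulrC ler_wpM2r // enormB.
apply: le_trans (ler_enorm_norm _) _.
apply: (@le_trans _ _ (k.+1%:R * (e / k.+1%:R))); last by rewrite mulrC divfK.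
by apply: ler_pM => //; rewrite ler_nat.
Qed.

Lemma within_itv_proper (R : realType) (l t : R) : 0 < l -> 0 <= t <= l ->
  ProperFilter (within `[0, l]%classic t^').
Proof.
move=> l0 /andP[t0 tl]; apply: Build_ProperFilter_ex => P.
rewrite /within /= => -[r /= r0 Hr].
pose d := Num.min r l / 2.
have d0 : 0 < d by rewrite divr_gt0 // lt_min r0.
have dl : d <= l / 2 by rewrite /d ler_pM2r ?invr_gt0 // ge_min lexx orbT.
have dr : d < r.
  by rewrite /d ltr_pdivrMr // (@le_lt_trans _ _ r) ?ge_min ?lexx // ltr_pMr // ltr1n.
have [tl2|tl2] := leP t (l / 2).
  exists (t + d); apply: Hr => /=.
  - by rewrite opprD addrA subrr sub0r normrN gtr0_norm.
  - by rewrite gt_eqF // ltrDl.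
  - by rewrite in_itv /=; apply/andP; split; lra.
exists (t - d); apply: Hr => /=.
- by rewrite opprB addrA addrAC subrr add0r gtr0_norm.
- by rewrite lt_eqF // ltrBlDr ltrDl.
- by rewrite in_itv /=; apply/andP; split; lra.
Qed.

(** The derivative relative to the interval may be computed from any differentiable local
    extension of the curve, also at the endpoints. *)
Lemma cderivE (R : realType) (k : nat) (l t r : R) (gam f : R -> 'rV[R]_k) (d : 'rV[R]_k) :
  0 < l -> 0 <= t <= l -> 0 < r ->
  (forall s, 0 <= s <= l -> `|s - t| < r -> gam s = f s) ->
  is_derive t 1 f d -> cderiv `[0, l] gam t = d.
Proof.
move=> l0 tl r0 gamf df; rewrite /cderiv.
have := within_itv_proper l0 tl => ?.
apply: cvg_lim => //; apply/cvgrPdist_le => e e0.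
have [r1 r1_gt0 Hr] := is_derive_expansion df e0.
rewrite /within /=; exists (Num.min r r1); first by rewrite /= lt_min r0.
move=> s /=; rewrite distrC lt_min => /andP[sr sr1] st.
rewrite in_itv /= => sl.
rewrite (gamf _ sl sr) (gamf _ tl) ?subrr ?normr0 //.
have st0 : s - t != 0 by rewrite subr_eq0.
rewrite -(ler_pM2r (_ : 0 < `|s - t|)) ?normr_gt0 //; apply: le_trans (Hr _ sr1).
rewrite (_ : f s - _ - _ = (s - t) *: ((s - t)^-1 *: (f s - f t) - d)); last first.
  by rewrite scalerBr scalerA mulfV // scale1r.
by rewrite enormZ mulrC ler_wpM2l // distrC ler_norm_enorm.
Qed.

Lemma cderiv_interior (R : realType) (k : nat) (l t : R) (gam : R -> 'rV[R]_k) (d : 'rV[R]_k) :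
  0 < t < l -> is_derive t 1 gam d -> cderiv `[0, l] gam t = d.
Proof.
move=> /andP[t0 tl]; apply: (@cderivE _ _ _ _ 1) => //; first exact: lt_trans tl.
by rewrite !ltW.
Qed.

Lemma lipschitz_enorm (R : realType) (k : nat) (l : R) (gam : R -> 'rV[R]_k) :
  [lipschitz gam t | t in `[0, l]] -> exists C, forall s t, 0 <= s <= l -> 0 <= t <= l ->
    enorm (gam s - gam t) <= C * `|s - t|.
Proof.
move=> [D [_ /(_ (D + 1))]]; rewrite ltrDl ltr01 => /(_ isT) H.
exists (k%:R * (D + 1)) => s t sl tl; apply: le_trans (ler_enorm_norm _) _.
rewrite -mulrA ler_wpM2l //; apply: (H (s, t)) => /=.
by rewrite !in_itv.
Qed.

Lemma enorm_lipschitz (R : realType) (k : nat) (l C : R) (gam : R -> 'rV[R]_k) :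
  (forall s t, 0 <= s <= l -> 0 <= t <= l -> enorm (gam s - gam t) <= C * `|s - t|) ->
  [lipschitz gam t | t in `[0, l]].
Proof.
move=> H; exists C; split; first exact: num_real.
move=> D CD [s t] /=; rewrite !in_itv /= => -[sl tl].
apply: le_trans (ler_norm_enorm _) _; apply: le_trans (H _ _ sl tl) _.
by rewrite ler_wpM2r // ltW.
Qed.

(** The form in which [lipschitz_FTC] is used: a pointwise bound on the derivative
    integrates. *)
Lemma lipschitz_ae_le (R : realType) (l C B : R) (f F : R -> R) (a b : R) :
  0 < l -> (forall x y, 0 <= x <= l -> 0 <= y <= l -> `|f x - f y| <= C * `|x - y|) ->
  measurable_fun setT F -> (forall t, `|F t| <= B) ->
  {ae @lebesgue_measure R, forall t, 0 < t < l -> exists2 d : R, is_derive t 1 f d & d <= F t} ->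
  0 <= a -> a <= b -> b <= l ->
  f b - f a <= \int[@lebesgue_measure R]_(t in `]a, b]) F t.
Proof.
move=> l0 lipf mF FB dF a0 ab bl.
have [g [mg gB dg gE]] := lipschitz_FTC l0 lipf.
rewrite (gE _ _ a0 ab bl).
pose G t := Num.max (g t) (F t).
have mG : measurable_fun setT G by exact: measurable_maxr.
have GB t : `|G t| <= Num.max `|C| B.
  by rewrite /G; case: (leP (g t) (F t)) => _; rewrite le_max ?FB ?gB ?orbT.
apply: (@le_trans _ _ (\int[@lebesgue_measure R]_(t in `]a, b]) G t)).
  apply: le_Rintegral => //.
  - exact: itv_bounded_integrable gB.
  - exact: itv_bounded_integrable GB.
  - by move=> t _; rewrite le_max lexx.
rewrite le_eqVlt; apply/orP; left; apply/eqP.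
congr fine; apply: ae_eq_integral => //.
- by apply/measurable_EFinP; exact: measurable_funTS.
- by apply/measurable_EFinP; exact: measurable_funTS.
move: dF (ae_neq l) dg; apply: filterS3; first exact: (ae_filter_ringOfSetsType lebesgue_measure).
move=> t dFt tl dgt /=; rewrite in_itv /= => /andP[ta tb].
have tl0 : 0 < t < l by rewrite (le_lt_trans a0 ta) lt_neqAle tl (le_trans tb bl).
have [d df dF'] := dFt tl0; have df' := dgt tl0.
congr EFin; rewrite /G; apply: max_idPr.
by rewrite -(@derive_val _ _ _ _ _ _ _ df') (@derive_val _ _ _ _ _ _ _ df).
Qed.

Lemma is_derive_rVP (R : realType) (k : nat) (f : R -> 'rV[R]_k) (t : R) (d : 'rV[R]_k) :
  is_derive t 1 f d <-> forall i, is_derive t 1 (fun s => f s 0 i) (d 0 i).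
Proof.
split=> [df i|df].
  have dft : derivable f t 1 by exact: ex_derive.
  have dfi : derivable (fun s => f s 0 i) t 1 by exact: (derivable_mxP _ _ _).1.
  split => //; have <- := @derive_val _ _ _ _ _ _ _ df.
  by rewrite derive_mx // mxE.
have dft : derivable f t 1.
  by apply/derivable_mxP => j i; rewrite (ord1 j); have := df i => ?; exact: ex_derive.
split => //; rewrite derive_mx //; apply/rowP => i; rewrite mxE.
exact: (@derive_val _ _ _ _ _ _ _ (df i)).
Qed.

Lemma is_derive_dot (R : realType) (k : nat) (f g : R -> 'rV[R]_k) (t : R) (df dg : 'rV[R]_k) :
  is_derive t 1 f df -> is_derive t 1 g dg ->
  is_derive t 1 (fun s => dot (f s) (g s)) (dot df (g t) + dot (f t) dg).
Proof.
move=> /is_derive_rVP Hf /is_derive_rVP Hg.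
have H i : is_derive t 1 (fun s => f s 0 i * g s 0 i) (df 0 i * g t 0 i + f t 0 i * dg 0 i).
  have ? := Hf i; have ? := Hg i.
  by apply: is_derive_eq; rewrite /GRing.scale /= addrC; congr (_ + _); rewrite mulrC.
have := @is_derive_sum _ _ _ _ (fun i s => f s 0 i * g s 0 i) t 1 _ H.
rewrite big_split /= /dot (_ : \sum_(i < k) _ = (fun s => \sum_i f s 0 i * g s 0 i)) //.
by apply/funext => s; rewrite fct_sumE.
Qed.

Lemma measurable_dot (R : realType) (k : nat) (f g : R -> 'rV[R]_k) :
  (forall i, measurable_fun setT (fun t => f t 0 i)) ->
  (forall i, measurable_fun setT (fun t => g t 0 i)) ->
  measurable_fun setT (fun t => dot (f t) (g t)).
Proof.
by move=> mf mg; apply: measurable_sum => i; exact: measurable_funM.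
Qed.

Lemma measurable_enorm (R : realType) (k : nat) (f : R -> 'rV[R]_k) :
  (forall i, measurable_fun setT (fun t => f t 0 i)) ->
  measurable_fun setT (fun t => enorm (f t)).
Proof.
move=> mf; have msqrt : measurable_fun setT (@Num.sqrt R).
  by apply: continuous_measurable_fun; exact: sqrt_continuous.
exact: (measurableT_comp msqrt (measurable_dot mf mf)).
Qed.

(** A bounded measurable representative of the derivative of gam. *)
Definition velocity (R : realType) (k : nat) (l : R) (gam g : R -> 'rV[R]_k) :=
  [/\ forall i, measurable_fun setT (fun t => g t 0 i),
      exists B, forall t, enorm (g t) <= B &
      {ae @lebesgue_measure R, forall t, 0 < t < l -> is_derive t 1 gam (g t)}].

Lemma lipschitz_velocity (R : realType) (k : nat) (l C : R) (gam : R -> 'rV[R]_k) : 0 < l ->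
  (forall s t, 0 <= s <= l -> 0 <= t <= l -> enorm (gam s - gam t) <= C * `|s - t|) ->
  exists g, velocity l gam g.
Proof.
move=> l0 lipg.
have /choice[g Hg] : forall i : 'I_k, exists g : R -> R, [/\ measurable_fun setT g,
    forall t, `|g t| <= `|C| &
    {ae @lebesgue_measure R, forall t, 0 < t < l -> is_derive t 1 (fun s => gam s 0 i) (g t)}].
  move=> i; have [|g [mg gB dg _]] := @lipschitz_FTC R l C (fun s => gam s 0 i) l0.
    move=> s t sl tl; apply: le_trans (lipg _ _ sl tl).
    apply: le_trans (ler_norm_enorm _).
    by apply: le_trans (ler_coord_norm _ i); rewrite !mxE.
  by exists g; split.
exists (fun t => \row_i g i t); split.
- move=> i; have [mg _ _] := Hg i.
  by rewrite (_ : (fun t => _) = g i) //; apply/funext => t; rewrite mxE.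
- exists (k%:R * `|C|) => t; apply: le_trans (ler_enorm_norm _) _; rewrite ler_wpM2l //.
  by apply: rV_norm_le => // i; rewrite mxE; have [_ + _] := Hg i; exact.
have : {ae @lebesgue_measure R, forall t, forall i, 0 < t < l ->
    is_derive t 1 (fun s => gam s 0 i) (g i t)}.
  apply: (@filter_forall _ _ _ _ (ae_filter_ringOfSetsType lebesgue_measure)) => i.
  by have [] := Hg i.
apply: filterS; first exact: (ae_filter_ringOfSetsType lebesgue_measure).
by move=> t H tl; apply/is_derive_rVP => i; rewrite mxE; exact: H.
Qed.

Lemma velocity_cderiv (R : realType) (k : nat) (l : R) (gam g : R -> 'rV[R]_k) :
  velocity l gam g ->
  {ae @lebesgue_measure R, forall t, 0 <= t <= l -> cderiv `[0, l] gam t = g t}.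
Proof.
move=> [_ _ dg].
move: (ae_neq (0 : R)) (ae_neq l) dg; apply: filterS3;
  first exact: (ae_filter_ringOfSetsType lebesgue_measure).
move=> t t0 tl dt /andP[t0' tl'].
have tt : 0 < t < l by rewrite !lt_neqAle tl tl' t0' eq_sym t0.
exact: (cderiv_interior tt (dt tt)).
Qed.

(** [cderiv] enters length, energy and distance of curves only through integrals, where it
    may be replaced by a measurable representative. *)
Lemma Rintegral_velocity (R : realType) (k : nat) (l : R) (gam g : R -> 'rV[R]_k)
    (F : R -> 'rV[R]_k -> R) : velocity l gam g ->
  (forall t v, 0 <= F t v) -> measurable_fun setT (fun t => F t (g t)) ->
  \int[@lebesgue_measure R]_(t in `[0, l]) F t (cderiv `[0, l] gam t) =
  \int[@lebesgue_measure R]_(t in `[0, l]) F t (g t).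
Proof.
move=> vg F0 mF; congr fine; apply: ge0_ae_eq_integral_rep => //.
- by apply/measurable_EFinP; exact: measurable_funTS.
- by move=> t _; rewrite lee_fin.
- by move=> t _; rewrite lee_fin.
have := velocity_cderiv vg.
apply: filterS; first exact: (ae_filter_ringOfSetsType lebesgue_measure).
by move=> t H /=; rewrite in_itv /= => tl; rewrite H.
Qed.

(** Apply [lipschitz_ae_le] to <u, gam> with u = gam b - gam a. *)
Lemma enorm_increment_le (R : realType) (k : nat) (l C B : R) (gam : R -> 'rV[R]_k) (F : R -> R)
    (a b : R) : 0 < l ->
  (forall s t, 0 <= s <= l -> 0 <= t <= l -> enorm (gam s - gam t) <= C * `|s - t|) ->
  measurable_fun setT F -> (forall t, `|F t| <= B) ->
  {ae @lebesgue_measure R, forall t, 0 < t < l ->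
    exists2 d, is_derive t 1 gam d & enorm d <= F t} ->
  0 <= a -> a <= b -> b <= l ->
  enorm (gam b - gam a) <= \int[@lebesgue_measure R]_(t in `]a, b]) F t.
Proof.
move=> l0 lipg mF FB dg a0 ab bl.
set u := gam b - gam a.
suff H : enorm u * enorm u <= enorm u * \int[@lebesgue_measure R]_(t in `]a, b]) F t.
  have [u0|u0] := eqVneq u 0; last by rewrite -(ler_pM2l (enorm_gt0 u0)).
  rewrite u0 enorm0 -[X in X <= _](subrr 0).
  apply: (@lipschitz_ae_le _ l 0 B (cst 0)) => // [x y _ _|].
    by rewrite /cst subrr normr0 mul0r.
  move: dg; apply: filterS; first exact: (ae_filter_ringOfSetsType lebesgue_measure).
  move=> t dgt tl; have [d _ dF] := dgt tl.
  by exists 0; [exact: is_derive_cst|exact: le_trans (enorm_ge0 _) dF].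
rewrite -expr2 sqr_enorm {2}/u dotBr.
rewrite -RintegralZl //; last exact: itv_bounded_integrable FB.
apply: (@lipschitz_ae_le _ l (enorm u * C) (enorm u * B) (fun t => dot u (gam t))) => //.
- move=> s t sl tl; rewrite -dotBr; apply: le_trans (cauchy_schwarz _ _) _.
  by rewrite -mulrA ler_wpM2l ?enorm_ge0 ?lipg.
- exact: measurable_funM.
- by move=> t; rewrite normrM ler_pM // ger0_norm ?enorm_ge0.
move: dg; apply: filterS; first exact: (ae_filter_ringOfSetsType lebesgue_measure).
move=> t dgt tl; have [d dg dF] := dgt tl; exists (dot u d).
  by have := is_derive_dot (is_derive_cst u t 1) dg; rewrite dot0l add0r.
by apply: le_trans (dot_le _ _) _; rewrite ler_wpM2l ?enorm_ge0.
Qed.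

Lemma is_derive_lipschitz_le (R : realType) (k : nat) (l C t : R)
    (gam : R -> 'rV[R]_k) (d : 'rV[R]_k) :
  (forall s t, 0 <= s <= l -> 0 <= t <= l -> enorm (gam s - gam t) <= C * `|s - t|) ->
  0 < t < l -> is_derive t 1 gam d -> enorm d <= C.
Proof.
move=> lipg /andP[t0 tl] dg.
apply: (@small_multiples_le _ _ _ 1) => e e0 _; rewrite mulr1.
have [r r0 Hr] := is_derive_expansion dg e0.
pose h := Num.min r (l - t) / 2.
have h0 : 0 < h by rewrite divr_gt0 // lt_min r0 subr_gt0.
have : h < Num.min r (l - t) by rewrite ltr_pdivrMr // ltr_pMr ?ltr1n // lt_min r0 subr_gt0.
rewrite lt_min => /andP[hr hl].
have := Hr (h + t); rewrite addrK gtr0_norm // => /(_ hr) Hd.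
have htl : 0 <= h + t <= l by apply/andP; split; lra.
have tl' : 0 <= t <= l by rewrite !ltW.
have := lipg (h + t) t htl tl'; rewrite addrK gtr0_norm // => Hl.
rewrite -(ler_pM2l h0) -[in leLHS](gtr0_norm h0) -enormZ.
rewrite (_ : h *: d = gam (h + t) - gam t - (gam (h + t) - gam t - h *: d)); last by rewrite subKr.
by apply: le_trans (ler_enormB _ _) _; rewrite mulrDr mulrC (mulrC h e) lerD.
Qed.

Lemma curve_length_le (R : realType) (k : nat) (l C : R) (gam : R -> 'rV[R]_k) : 0 < l ->
  (forall s t, 0 <= s <= l -> 0 <= t <= l -> enorm (gam s - gam t) <= C * `|s - t|) ->
  curve_length l gam <= C * l.
Proof.
move=> l0 lipg; have [g vg] := lipschitz_velocity l0 lipg; have [mg [B gB] dg] := vg.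
have C0 : 0 <= C.
  have := lipg 0 l; rewrite lexx (ltW l0) lexx => /(_ isT isT) h.
  have := le_trans (enorm_ge0 _) h; rewrite sub0r normrN pmulr_lge0 ?normr_gt0 ?gt_eqF //.
have mn : measurable_fun setT (fun t => enorm (g t)) by exact: measurable_enorm.
pose G t := Num.min (enorm (g t)) C.
have G0 t : 0 <= G t by rewrite le_min enorm_ge0.
have GC t : `|G t| <= C by rewrite ger0_norm // ge_min lexx orbT.
have mG : measurable_fun setT G by exact: measurable_minr.
have -> : curve_length l gam = \int[@lebesgue_measure R]_(t in `[0, l]) G t.
  congr fine; apply: ge0_ae_eq_integral_rep => //.
  - by apply/measurable_EFinP; exact: measurable_funTS.
  - by move=> t _; rewrite lee_fin enorm_ge0.
  - by move=> t _; rewrite lee_fin.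
  move: (ae_neq (0 : R)) (ae_neq l) dg; apply: filterS3;
  first exact: (ae_filter_ringOfSetsType lebesgue_measure).
  move=> t t0 tl dt; rewrite /= in_itv /= => /andP[t0' tl'].
  have tt : 0 < t < l by rewrite !lt_neqAle tl tl' t0' eq_sym t0.
  rewrite (cderiv_interior tt (dt tt)) /G (min_idPl _) //.
  exact: (is_derive_lipschitz_le lipg tt (dt tt)).
rewrite -[X in C * X]subr0 -(@Rintegral_itv_cst _ true false) ?(ltW l0) //.
apply: le_Rintegral => //.
- exact: itv_bounded_integrable GC.
- by apply: (@itv_bounded_integrable _ _ _ _ _ C) => // t; rewrite ger0_norm.
- by move=> t _; rewrite (le_trans (ler_norm _)).
Qed.

(** * Normal deviation in terms of the intrinsic distance *)

(** For every e > 0 there is a Lipschitz curve of length less than D + e; its arc length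
    from 0 plays the role of len in [normal_deviation_curve]. *)
Lemma rdist_normal_deviation (R : realType) (k m : nat) (M : set 'rV[R]_k) (A c D : R)
    (p q nu : 'rV[R]_k) :
  submanifold m M -> 0 <= A -> A < c -> (sup_sff m M <= A%:E)%E ->
  0 <= D -> (rdist M p q <= D%:E)%E -> orthogonal_to nu (tangent m M p) ->
  `|dot nu (q - p)| <= c * D ^+ 2 * enorm nu.
Proof.
move=> subM A0 Ac supA D0 pqD nu_perp.
have c0 : 0 < c by exact: le_lt_trans Ac.
apply: (@small_multiples_le _ _ _ (c * (2 * D + 1) * enorm nu)) => e e0 e1.
have : (rdist M p q < (D + e)%:E)%E by apply: le_lt_trans pqD _; rewrite lte_fin ltrDl.
move=> /ereal_inf_lt[_ [gam [gam_lip gamM gam0 gam1] <-]]; rewrite lte_fin => gam_len.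
have [C HC] := lipschitz_enorm gam_lip.
have [g vg] := lipschitz_velocity ltr01 HC.
have [mg [B gB] _] := vg.
have mn : measurable_fun setT (fun t => enorm (g t)) by exact: measurable_enorm.
have gBn t : `|enorm (g t)| <= B by rewrite ger0_norm ?enorm_ge0.
pose len t := \int[@lebesgue_measure R]_(s in `]0, t]) enorm (g s).
have lenB s t : 0 <= s -> s <= t ->
    len t - len s = \int[@lebesgue_measure R]_(r in `]s, t]) enorm (g r).
  move=> s0 st; rewrite /len Rintegral_itvB ?bnd_simp //.
  exact: itv_bounded_integrable gBn.
have len1 : len 1 - len 0 = curve_length 1 gam.
  rewrite lenB ?ler01 // Rintegral_itv_obnd_cbnd; last exact: itv_bounded_integrable gBn.
  by rewrite -(@Rintegral_velocity _ _ _ gam g (fun _ v => enorm v)) // => t v; exact: enorm_ge0.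
have len1_ge0 : 0 <= len 1 - len 0.
  by rewrite len1; apply: Rintegral_ge0 => t _; exact: enorm_ge0.
have gamMs t : 0 <= t -> t <= 1 -> M (gam t).
  by move=> t0 t1; apply: gamM; rewrite in_itv /= t0.
have lipC s t : 0 <= s -> s <= t -> t <= 1 -> enorm (gam t - gam s) <= C * (t - s).
  move=> s0 st t1; have := HC t s; rewrite s0 t1 (le_trans s0 st) (le_trans st t1).
  by rewrite (ger0_norm (_ : 0 <= t - s)) ?subr_ge0 //; exact.
have lenC s t : 0 <= s -> s <= t -> t <= 1 -> enorm (gam t - gam s) <= len t - len s.
  move=> s0 st t1; rewrite lenB //; apply: (enorm_increment_le ltr01 HC mn gBn) => //.
  have [_ _] := vg; apply: filterS; first exact: (ae_filter_ringOfSetsType lebesgue_measure).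
  by move=> r dgr r01; exists (g r) => //; exact: dgr.
rewrite -gam0 in nu_perp *; rewrite -gam1.
apply: le_trans (normal_deviation_curve subM A0 Ac supA gamMs lipC lenC nu_perp) _.
have nn := enorm_ge0 nu.
have h : (len 1 - len 0) ^+ 2 <= D ^+ 2 + e * (2 * D + 1).
  apply: (@le_trans _ _ ((D + e) ^+ 2)).
    have De : 0 <= D + e by rewrite addr_ge0 // ltW.
    by rewrite ler_sqr ?nnegrE // len1 ltW.
  have := ler_wpM2l (ltW e0) e1; rewrite mulr1 sqrrD -expr2; lra.
apply: le_trans (ler_wpM2r nn (ler_wpM2l (ltW c0) h)) _.
by rewrite le_eqVlt; apply/orP; left; apply/eqP; ring.
Qed.

(** * Geodesics *)

Lemma MVT_interior (R : realType) (f df : R -> R) (a b d : R) : a <= b ->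
  (forall x, a < x < b -> is_derive x 1 f (df x)) ->
  (forall x, a < x < b -> `|df x| <= d) ->
  (forall x, a <= x <= b -> forall e : R, 0 < e -> exists2 r : R, 0 < r &
    forall y, a <= y <= b -> `|y - x| < r -> `|f y - f x| <= e) ->
  `|f b - f a| <= d * (b - a).
Proof.
rewrite le_eqVlt => /orP[/eqP <-|ab] dfE df_le fc; first by rewrite !subrr normr0 mulr0.
have dfE' x : x \in `]a, b[ -> is_derive x 1 f (df x) by rewrite in_itv /=; exact: dfE.
have fc' : {within `[a, b], continuous f}.
  apply/subspace_continuousP => x /=; rewrite in_itv /= => xab.
  apply/cvgrPdist_le => e e0; have [r r0 Hr] := fc x xab e e0.
  rewrite /within /=; exists r => // y /= yx; rewrite in_itv /= => yab.
  by rewrite distrC Hr // distrC.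
have [c + ->] := MVT ab dfE' fc'.
rewrite in_itv /= => cab.
rewrite normrM (ger0_norm (_ : 0 <= b - a)) ?subr_ge0 ?(ltW ab) //.
by rewrite ler_wpM2r ?subr_ge0 ?(ltW ab) ?df_le.
Qed.

Definition continuous_in (R : realType) (k : nat) (l : R) (f : R -> 'rV[R]_k) :=
  forall x, 0 <= x <= l -> forall e : R, 0 < e -> exists2 r : R, 0 < r &
    forall y, 0 <= y <= l -> `|y - x| < r -> enorm (f y - f x) <= e.

Lemma interior_lipschitz (R : realType) (k : nat) (l d : R) (f df : R -> 'rV[R]_k) :
  (forall x, 0 < x < l -> is_derive x 1 f (df x)) ->
  (forall x, 0 < x < l -> enorm (df x) <= d) -> continuous_in l f ->
  forall s t, 0 <= s <= l -> 0 <= t <= l -> enorm (f s - f t) <= d * `|s - t|.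
Proof.
move=> dfE df_le fc.
suff H s t : 0 <= s -> s <= t -> t <= l -> enorm (f t - f s) <= d * (t - s).
  move=> s t /andP[s0 sl] /andP[t0 tl]; have [st|/ltW ts] := leP s t.
    by rewrite enormB distrC ger0_norm ?subr_ge0 ?H.
  by rewrite ger0_norm ?subr_ge0 ?H.
move=> s0 st tl; set u := f t - f s.
have [u0|u0] := eqVneq u 0.
  rewrite u0 enorm0; move: st; rewrite le_eqVlt => /orP[/eqP ->|st]; first by rewrite subrr mulr0.
  rewrite mulr_ge0 ?subr_ge0 ?(ltW st) // (le_trans _ (df_le ((s + t) / 2) _)) ?enorm_ge0 //.
  by apply/andP; split; lra.
have nu := enorm_gt0 u0.
rewrite -(ler_pM2l nu) -expr2 sqr_enorm {2}/u dotBr mulrA.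
apply: le_trans (ler_norm _) _.
have inl x : s < x < t -> 0 < x < l by move=> /andP[sx xt]; apply/andP; split; lra.
have inl' x : s <= x <= t -> 0 <= x <= l by move=> /andP[sx xt]; apply/andP; split; lra.
apply: (@MVT_interior _ (fun x => dot u (f x)) (fun x => dot u (df x))) => //.
- move=> x /inl xl; have := is_derive_dot (is_derive_cst u x 1) (dfE _ xl).
  by rewrite dot0l add0r.
- move=> x /inl xl; apply: le_trans (cauchy_schwarz _ _) _.
  by rewrite ler_wpM2l ?(ltW nu) ?df_le.
- move=> x /inl' xl e e0; have [r r0 Hr] := fc x xl (e / enorm u) (divr_gt0 e0 nu).
  exists r => // y /inl' yl yx; rewrite -dotBr; apply: le_trans (cauchy_schwarz _ _) _.
  by rewrite mulrC -ler_pdivlMr ?Hr.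
Qed.

Section Geodesic.
Variables (R : realType) (k m : nat) (M : set 'rV[R]_k) (l : R) (sig : R -> 'rV[R]_k).
Hypotheses (subM : submanifold m M) (l0 : 0 < l) (geo : geodesic m M `[0, l] sig).

Let b := cderiv `[0, l] sig.
Let b' := cderiv `[0, l] b.

Let extension t : 0 <= t <= l -> exists (r : R) (F F1 F2 : R -> 'rV[R]_k), [/\ 0 < r,
  forall s, 0 <= s <= l -> `|s - t| < r -> sig s = F s,
  forall s, `|s - t| < r -> is_derive s 1 F (F1 s) &
  forall s, `|s - t| < r -> is_derive s 1 F1 (F2 s)].
Proof.
move=> tl; have [/(_ t) + _] := geo.
rewrite /= in_itv /= => /(_ tl)[U [F [oU Ut CF Ff]]].
have /nbhs_ballP[r r0 Hr] : nbhs t U by exact: open_nbhs_nbhs.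
have HU s : `|s - t| < r -> U s by move=> st; apply: Hr; rewrite /ball /= distrC.
have [dF /(_ 1)[dF1 _]] := CF 2%N.
exists r, F, (fun s => 'D_1 F s), (fun s => 'D_1 (fun s => 'D_1 F s) s); split => //.
- by move=> s sl st; rewrite Ff //; exact: HU.
- by move=> s /HU Us; split => //; exact: dF.
- by move=> s /HU Us; split => //; exact: dF1.
Qed.

Let extension_velocity t r (F F1 : R -> 'rV[R]_k) : 0 <= t <= l -> 0 < r ->
  (forall s, 0 <= s <= l -> `|s - t| < r -> sig s = F s) ->
  (forall s, `|s - t| < r -> is_derive s 1 F (F1 s)) ->
  forall s, 0 <= s <= l -> `|s - t| < r -> b s = F1 s.
Proof.
move=> tl r0 sigF dF s sl st.
apply: (@cderivE _ _ _ _ (r - `|s - t|) _ F) => //; first by rewrite subr_gt0.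
  move=> z zl; rewrite ltrBrDr => zs; apply: sigF => //.
  by rewrite -(subrKA s); apply: le_lt_trans (ler_normD _ _) _.
exact: dF.
Qed.

Lemma geodesic_continuous : continuous_in l sig /\ continuous_in l b.
Proof.
have H (f g : R -> 'rV[R]_k) (x r : R) d : 0 < r -> is_derive x 1 f d -> 0 <= x <= l ->
    (forall y, 0 <= y <= l -> `|y - x| < r -> g y = f y) ->
    forall e : R, 0 < e -> exists2 r : R, 0 < r & forall y, 0 <= y <= l -> `|y - x| < r -> enorm (g y - g x) <= e.
  move=> r0 df xl gf e e0; have [r1 r1_gt0 Hr] := is_derive_expansion df ltr01.
  have d1 : 0 < 1 + enorm d by rewrite ltr_pwDl // enorm_ge0.
  exists (Num.min r (Num.min r1 (e / (1 + enorm d)))).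
    by rewrite !lt_min r0 r1_gt0 divr_gt0.
  move=> y yl; rewrite !lt_min => /and3P[yr yr1 ye].
  rewrite !gf ?subrr ?normr0 // -[f y - f x](subrK ((y - x) *: d)).
  apply: le_trans (ler_enormD _ _) _; rewrite enormZ.
  apply: le_trans (lerD (Hr _ yr1) (lexx _)) _.
  by rewrite mul1r -{1}[`|y - x|]mulr1 -mulrDr -ler_pdivlMr // ltW.
split=> x xl; have [r [F [F1 [F2 [r0 sigF dF dF1]]]]] := extension xl.
  by apply: (H F sig x r (F1 x)) => //; apply: dF; rewrite subrr normr0.
apply: (H F1 b x r (F2 x)) => //; first by apply: dF1; rewrite subrr normr0.
exact: extension_velocity sigF dF.
Qed.

Lemma geodesic_derive t : 0 < t < l -> is_derive t 1 sig (b t) /\ is_derive t 1 b (b' t).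
Proof.
move=> /andP[t0 tl]; have tl' : 0 <= t <= l by rewrite !ltW.
have [r [F [F1 [F2 [r0 sigF dF dF1]]]]] := extension tl'.
have bF := extension_velocity tl' r0 sigF dF.
have tt : `|t - t| < r by rewrite subrr normr0.
have b'F : b' t = F2 t.
  by apply: (@cderivE _ _ _ _ r _ F1) => //; exact: dF1.
have nt : \forall s \near t, 0 <= s <= l /\ `|s - t| < r.
  near=> s; split.
    apply/andP; split; apply: ltW; near: s; [exact: lt_nbhsr|exact: lt_nbhsl].
  by near: s; apply/nbhs_ballP; exists r => // s; rewrite /ball /= distrC.
split.
  rewrite (bF t) //; apply: near_eq_is_derive (dF _ tt).
  by apply: filterS nt => s [sl st]; rewrite sigF.
rewrite b'F; apply: near_eq_is_derive (dF1 _ tt).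
by apply: filterS nt => s [sl st]; rewrite bF.
Unshelve. all: by end_near.
Qed.

Lemma geodesic_subset t : 0 <= t <= l -> M (sig t).
Proof. by move=> tl; have [_ /(_ t)] := geo; rewrite /= in_itv => /(_ tl)[]. Qed.

Lemma geodesic_acceleration_normal t : 0 <= t <= l -> orthogonal_to (b' t) (tangent m M (sig t)).
Proof. by move=> tl; have [_ /(_ t)] := geo; rewrite /= in_itv => /(_ tl)[]. Qed.

(** The velocity is a limit of secants of M. *)
Lemma geodesic_tangent t : 0 < t < l -> tangent m M (sig t) (b t).
Proof.
move=> /[dup] tl /andP[t0 tl'].
have Mt : M (sig t) by apply: geodesic_subset; rewrite !ltW.
apply: (tangent_approached subM Mt) => e d e0 d0.
have [r r0 Hr] := is_derive_expansion (geodesic_derive tl).1 e0.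
pose h := Num.min (Num.min d r) (l - t) / 2.
have h0 : 0 < h by rewrite divr_gt0 // !lt_min d0 r0 subr_gt0.
have : h < Num.min (Num.min d r) (l - t).
  by rewrite ltr_pdivrMr // ltr_pMr ?ltr1n // !lt_min d0 r0 subr_gt0.
rewrite !lt_min => /andP[/andP[hd hr] hl].
exists h, (sig (h + t)); rewrite gtr0_norm //; split => //.
  by apply: geodesic_subset; apply/andP; split; lra.
by have := Hr (h + t); rewrite addrK gtr0_norm //; exact.
Qed.

(** The derivative of |b|^2 is 2 <b', b>, and b is tangent while b' is normal. *)
Lemma geodesic_speed t : 0 <= t <= l -> enorm (b t) = enorm (b l).
Proof.
have [sc bc] := geodesic_continuous.
suff H s s' : 0 <= s -> s <= s' -> s' <= l -> enorm (b s) = enorm (b s').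
  by move=> /andP[t0 tl]; exact: H.
move=> s0 ss' sl; rewrite /enorm; congr Num.sqrt; apply/esym/eqP.
rewrite -subr_eq0 -normr_le0 -(mul0r (s' - s)).
have inl x : s < x < s' -> 0 < x < l by move=> /andP[? ?]; apply/andP; split; lra.
have inl' x : s <= x <= s' -> 0 <= x <= l by move=> /andP[? ?]; apply/andP; split; lra.
apply: (@MVT_interior _ (fun x => dot (b x) (b x))
  (fun x => dot (b' x) (b x) + dot (b x) (b' x))) => //.
- by move=> x /inl xl; apply: is_derive_dot; exact: (geodesic_derive xl).2.
- move=> x /inl xl; rewrite dotC (dotC (b x)).
  rewrite (geodesic_acceleration_normal _ (geodesic_tangent xl)) ?addr0 ?normr0 //.
  by have /andP[? ?] := xl; rewrite !ltW.
move=> x /inl' xl e e0.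
have nb := enorm_ge0 (b x).
have B0 : 0 < 2 * enorm (b x) + 1 by lra.
have e1 : 0 < Num.min 1 (e / (2 * enorm (b x) + 1)) by rewrite lt_min ltr01 divr_gt0.
have [r r0 Hr] := bc x xl _ e1.
exists r => // y /inl' yl yx; have := Hr y yl yx; rewrite le_min ler_pdivlMr // => /andP[h1 h2].
rewrite dot_subr_sqr.
apply: le_trans (cauchy_schwarz _ _) _; apply: le_trans h2; rewrite ler_wpM2l ?enorm_ge0 //.
by apply: le_trans (ler_enormD _ _) _; rewrite enormZ ger0_norm // addrC lerD2l.
Qed.

Lemma geodesic_lipschitz s t : 0 <= s <= l -> 0 <= t <= l ->
  enorm (sig s - sig t) <= enorm (b l) * `|s - t|.
Proof.
have [sc _] := geodesic_continuous.
apply: (@interior_lipschitz R k l (enorm (b l)) sig b) => [x xl|x /andP[x0 xl]|].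
- by have [] := geodesic_derive xl.
- by rewrite geodesic_speed // !ltW.
- exact: sc.
Qed.

(** With nu = b' t, the pairing <nu, b (t + h)> is at most c |b| h |b| |nu| since
    tangent spaces tilt at the rate c, while <nu, b t> = 0.  Dividing by h gives
    |nu|^2 <= c |b|^2 |nu|. *)
Lemma geodesic_acceleration_le (A c : R) t : 0 <= A -> A < c -> (sup_sff m M <= A%:E)%E ->
  0 < t < l -> enorm (b' t) <= c * enorm (b l) ^+ 2.
Proof.
move=> A0 Ac supA /[dup] tl /andP[t0 tl']; have tlw : 0 <= t <= l by rewrite !ltW.
have c0 : 0 < c by exact: le_lt_trans Ac.
set nu := b' t; set v := enorm (b l).
have v0 : 0 <= v by exact: enorm_ge0.
have nu_perp := geodesic_acceleration_normal tlw; rewrite -/nu in nu_perp.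
have [->|nu0] := eqVneq nu 0; first by rewrite enorm0 mulr_ge0 ?sqr_ge0 // ltW.
have nn := enorm_gt0 nu0.
apply: (@small_multiples_le _ _ _ 1) => e e0 _; rewrite mulr1.
have [r r0 Hr] := tilt_le_local subM A0 Ac supA (geodesic_subset tlw).
have [r1 r1_gt0 Hr1] := is_derive_expansion (geodesic_derive tl).2 e0.
have v1 : 0 < v + 1 by lra.
(* h is small enough for both expansions at t, and t + h < l. *)
pose h := Num.min (Num.min (r / (v + 1)) r1) (l - t) / 2.
have m0 : 0 < Num.min (Num.min (r / (v + 1)) r1) (l - t).
  by rewrite !lt_min r1_gt0 subr_gt0 tl' divr_gt0.
have h0 : 0 < h by rewrite divr_gt0.
have : h < Num.min (Num.min (r / (v + 1)) r1) (l - t).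
  by rewrite ltr_pdivrMr // ltr_pMr ?ltr1n.
rewrite !lt_min ltr_pdivlMr // => /andP[/andP[hr hr1] hl].
have hl' : 0 < h + t < l by apply/andP; split; lra.
have hlw : 0 <= h + t <= l by apply/andP; split; lra.
have lip := geodesic_lipschitz hlw tlw; rewrite addrK gtr0_norm // -/v in lip.
have := Hr1 (h + t); rewrite addrK gtr0_norm // => /(_ hr1) Hb.
have sig_near : enorm (sig (h + t) - sig t) < r.
  by apply: le_lt_trans lip _; apply: le_lt_trans hr; rewrite mulrC ler_wpM2l ?(ltW h0) // lerDl.
have tilt := Hr (sig (h + t)) (geodesic_subset hlw) sig_near _ _ nu_perp (geodesic_tangent hl').
rewrite (geodesic_speed hlw) -/v in tilt.
rewrite -(ler_pM2l (mulr_gt0 h0 nn)) -mulrA -expr2 sqr_enorm -dotZr.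
rewrite (_ : h *: nu = b (h + t) - b t - (b (h + t) - b t - h *: nu)); last by rewrite subKr.
rewrite dotBr dotBr (nu_perp _ (geodesic_tangent tl)) subr0.
apply: le_trans (ler_norm _) _; apply: le_trans (ler_normB _ _) _.
have h1 := le_trans (cauchy_schwarz nu _) (ler_wpM2l (ltW nn) Hb).
have h2 := le_trans tilt (ler_wpM2r v0 (ler_wpM2r (ltW nn) (ler_wpM2l (ltW c0) lip))).
apply: le_trans (lerD h2 h1) _.
by rewrite le_eqVlt; apply/orP; left; apply/eqP; ring.
Qed.

End Geodesic.

(** * Lipschitz potentials and the comparison of energies *)

(** [rdist_normal_deviation] with c = 1/12 and D = 2 |y - x|, for which c D^2 = |y - x|^2 / 3. *)
Lemma normal_deviation (R : realType) (k m : nat) (M : set 'rV[R]_k) (x y nu : 'rV[R]_k) :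
  submanifold m M -> (sup_sff m M <= (16^-1)%:E)%E ->
  (forall x y, M x -> M y -> enorm (x - y) <= 8 ->
    (rdist M x y <= (2 * enorm (x - y))%:E)%E) ->
  M x -> M y -> enorm (y - x) <= 8 -> orthogonal_to nu (tangent m M x) ->
  `|dot nu (y - x)| <= 3^-1 * enorm (y - x) ^+ 2 * enorm nu.
Proof.
move=> subM supM distM Mx My xy nu_perp.
have A0 : 0 <= 16^-1 :> R by rewrite invr_ge0.
have Ac : 16^-1 < 12^-1 :> R by rewrite ltf_pV2 ?posrE // ltr_nat.
have D0 : 0 <= 2 * enorm (y - x) by rewrite mulr_ge0 ?enorm_ge0.
have xyD : (rdist M x y <= (2 * enorm (y - x))%:E)%E.
  by rewrite enormB; apply: distM => //; rewrite enormB.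
apply: le_trans (rdist_normal_deviation subM A0 Ac supM D0 xyD nu_perp) _.
by move: (enorm _) (enorm nu) => a b; rewrite exprMn; lra.
Qed.

Definition lipschitz_in (R : realType) (k : nat) (l : R) (f : R -> 'rV[R]_k) :=
  exists2 C, 0 <= C & forall s t, 0 <= s <= l -> 0 <= t <= l -> enorm (f s - f t) <= C * `|s - t|.

Definition rlipschitz_in (R : realType) (l : R) (f : R -> R) :=
  exists2 C, 0 <= C & forall s t, 0 <= s <= l -> 0 <= t <= l -> `|f s - f t| <= C * `|s - t|.

Lemma lipschitz_inE (R : realType) (k : nat) (l C : R) (f : R -> 'rV[R]_k) :
  (forall s t, 0 <= s <= l -> 0 <= t <= l -> enorm (f s - f t) <= C * `|s - t|) ->
  lipschitz_in l f.
Proof.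
move=> HC; exists `|C| => // s t sl tl; apply: le_trans (HC _ _ sl tl) _.
by rewrite ler_wpM2r // ler_norm.
Qed.

Lemma lipschitz_bounded (R : realType) (k : nat) (l : R) (f : R -> 'rV[R]_k) :
  0 <= l -> lipschitz_in l f -> exists2 B, 0 <= B & forall t, 0 <= t <= l -> enorm (f t) <= B.
Proof.
move=> l0 [C C0 HC]; exists (C * l + enorm (f 0)).
  by rewrite addr_ge0 ?enorm_ge0 // mulr_ge0.
move=> t /[dup] tl /andP[t0 tl'].
rewrite -[X in enorm X](subrK (f 0)); apply: le_trans (ler_enormD _ _) _; rewrite lerD2r.
apply: le_trans (HC _ _ tl _) _; first by rewrite lexx l0.
by rewrite subr0 (ger0_norm t0) ler_wpM2l.
Qed.

Lemma lipschitz_inB (R : realType) (k : nat) (l : R) (f g : R -> 'rV[R]_k) :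
  lipschitz_in l f -> lipschitz_in l g -> lipschitz_in l (fun t => f t - g t).
Proof.
move=> [C C0 HC] [D D0 HD]; exists (C + D); first exact: addr_ge0.
move=> s t sl tl; rewrite opprD opprK addrACA (addrC (- g s)) mulrDl.
apply: le_trans (ler_enormD _ _) _; apply: lerD; first exact: HC.
by rewrite distrC HD.
Qed.

Lemma rlipschitz_dot (R : realType) (k : nat) (l : R) (f g : R -> 'rV[R]_k) : 0 <= l ->
  lipschitz_in l f -> lipschitz_in l g -> rlipschitz_in l (fun t => dot (f t) (g t)).
Proof.
move=> l0 lf lg; have [B B0 HB] := lipschitz_bounded l0 lf.
have [E E0 HE] := lipschitz_bounded l0 lg.
case: lf lg => [C C0 HC] [D D0 HD]; exists (C * E + B * D); first by rewrite addr_ge0 ?mulr_ge0.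
move=> s t sl tl.
rewrite (_ : dot (f s) (g s) - dot (f t) (g t) =
  dot (f s - f t) (g s) + dot (f t) (g s - g t)); last first.
  by rewrite dotBl dotBr addrA subrK.
apply: le_trans (ler_normD _ _) _; rewrite mulrDl; apply: lerD.
  apply: le_trans (cauchy_schwarz _ _) _; rewrite mulrAC.
  by apply: ler_pM; [exact: enorm_ge0|exact: enorm_ge0|exact: HC|exact: HE].
apply: le_trans (cauchy_schwarz _ _) _; rewrite -mulrA.
by apply: ler_pM; [exact: enorm_ge0|exact: enorm_ge0|exact: HB|exact: HD].
Qed.

Lemma rlipschitzD (R : realType) (l : R) (f g : R -> R) :
  rlipschitz_in l f -> rlipschitz_in l g -> rlipschitz_in l (fun t => f t + g t).
Proof.
move=> [C C0 HC] [D D0 HD]; exists (C + D); first exact: addr_ge0.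
move=> s t sl tl; rewrite opprD addrACA mulrDl.
by apply: le_trans (ler_normD _ _) _; apply: lerD; [exact: HC|exact: HD].
Qed.

Lemma rlipschitzM (R : realType) (l : R) (f g : R -> R) : 0 <= l ->
  rlipschitz_in l f -> rlipschitz_in l g -> rlipschitz_in l (fun t => f t * g t).
Proof.
move=> l0 lf lg.
have bounded (h : R -> R) : rlipschitz_in l h ->
    exists2 B, 0 <= B & forall t, 0 <= t <= l -> `|h t| <= B.
  move=> [C C0 HC]; exists (C * l + `|h 0|); first by rewrite addr_ge0 // mulr_ge0.
  move=> t /[dup] tl /andP[t0 tl'].
  rewrite -[X in `|X|](subrK (h 0)); apply: le_trans (ler_normD _ _) _; rewrite lerD2r.
  apply: le_trans (HC _ _ tl _) _; first by rewrite lexx l0.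
  by rewrite subr0 (ger0_norm t0) ler_wpM2l.
have [B B0 HB] := bounded _ lf; have [E E0 HE] := bounded _ lg.
case: lf lg => [C C0 HC] [D D0 HD]; exists (C * E + B * D); first by rewrite addr_ge0 ?mulr_ge0.
move=> s t sl tl.
rewrite (_ : f s * g s - f t * g t = (f s - f t) * g s + f t * (g s - g t)); last by ring.
apply: le_trans (ler_normD _ _) _; rewrite [leRHS]mulrDl !normrM; apply: lerD.
  by rewrite mulrAC; apply: ler_pM => //; [exact: HC|exact: HE].
by rewrite -mulrA; apply: ler_pM => //; [exact: HB|exact: HD].
Qed.

Lemma rlipschitz_inverse_shift (R : realType) (l a : R) : 0 < a ->
  rlipschitz_in l (fun t => (t + a)^-1).
Proof.
move=> a0; exists (a^-1 * a^-1); first by rewrite mulr_ge0 // invr_ge0 ltW.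
move=> s t /andP[s0 _] /andP[t0 _].
have sa : 0 < s + a by lra.
have ta : 0 < t + a by lra.
rewrite (_ : (s + a)^-1 - (t + a)^-1 = ((s + a)^-1 * (t + a)^-1) * (t - s)); last first.
  by field; rewrite !gt_eqF.
rewrite normrM distrC ler_wpM2r // ger0_norm ?mulr_ge0 ?invr_ge0 ?(ltW sa) ?(ltW ta) //.
apply: ler_pM; rewrite ?invr_ge0 ?(ltW sa) ?(ltW ta) //.
  by rewrite lef_pV2 ?posrE //; lra.
by rewrite lef_pV2 ?posrE //; lra.
Qed.
(** Here w is the weight 1 / (t + 1 / (10 L)), whose derivative is - w^2.  Completing the
    square absorbs (3/2) w <D, D'> into (19/20) |D'|^2 at the cost of (9/16) (20/19) w^2 |D|^2.
    Together with -(3/4) w^2 |D|^2 this leaves -(3/19) w^2 |D|^2, which outweighs the other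
    multiples of |D|^2: (3/19) (10/11)^2 L^2 >= L^2 / 18 + 1/20. *)
Lemma weight_inequality (R : realType) (k : nat) (D D' b b' : 'rV[R]_k) (L w : R) :
  1 <= L -> 10 / 11 * L <= w ->
  `|dot b' D| <= 36^-1 * L ^+ 2 * dot D D ->
  2 * (dot b' D + dot b D') + (- (3 / 4) * w ^+ 2 * dot D D + 3 / 4 * w * (2 * dot D D')) <=
  dot (b + D') (b + D') - dot b b - 20^-1 * (dot D D + dot D' D').
Proof.
move=> L1 wL b'D.
have h0 := dot_ge0 (D' - (15 / 19 * w) *: D).
have X0 := dot_ge0 D.
have h1 := le_trans (ler_norm _) b'D.
have w2 : (10 / 11 * L) ^+ 2 <= w ^+ 2.
  by rewrite ler_sqr ?nnegrE //; lra.
have L2 : 1 <= L ^+ 2 by rewrite -[leLHS](expr1n _ 2) ler_sqr ?nnegrE //; lra.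
rewrite !(dotDl, dotDr, dotBl, dotBr, dotZl, dotZr, dotNl, dotNr) in h0 *.
rewrite (dotC D' b) (dotC D' D) in h0 *.
move: (dot b' D) (dot b D') (dot D D) (dot D D') (dot D' D') (dot b b) h0 X0 h1 {b'D}.
move=> p q X Z Y e h0 X0 h1.
have h2 := ler_wpM2r X0 w2.
have h3 := ler_wpM2r X0 L2.
set L2' := L ^+ 2 in h1 h3.
have E2 : (10 / 11 * L) ^+ 2 = 100 / 121 * L2' by rewrite /L2'; field.
rewrite E2 in h2.
set W := w ^+ 2 in h2 *.
have h0' : 0 <= Y - 30 / 19 * (w * Z) + 225 / 361 * (W * X).
  by apply: le_trans h0 _; rewrite le_eqVlt; apply/orP; left; apply/eqP; rewrite /W; field.
rewrite -(mulrA _ L2') in h1; rewrite -(mulrA _ L2') in h2; rewrite mul1r in h3.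
have -> : 3 / 4 * w * (2 * Z) = 3 / 2 * (w * Z) by field.
rewrite -(mulrA _ W).
move: (W * X) (L2' * X) (w * Z) h0' h1 h2 h3 => WX LX wZ; lra.
Qed.

Lemma ae_speed_lipschitz (R : realType) (k : nat) (l L : R) (gam : R -> 'rV[R]_k) : 0 < l ->
  [lipschitz gam t | t in `[0, l]] ->
  {ae @lebesgue_measure R, forall t, t \in `[0, l] -> enorm (cderiv `[0, l] gam t) <= L} ->
  forall s t, 0 <= s <= l -> 0 <= t <= l -> enorm (gam s - gam t) <= L * `|s - t|.
Proof.
move=> l0 /lipschitz_enorm[C lipg] gamL.
have [g [_ _ dg]] := lipschitz_velocity l0 lipg.
suff H s t : 0 <= s -> s <= t -> t <= l -> enorm (gam t - gam s) <= L * (t - s).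
  move=> s t /andP[s0 sl] /andP[t0 tl]; have [st|/ltW ts] := leP s t.
    by rewrite enormB distrC ger0_norm ?subr_ge0 ?H.
  by rewrite ger0_norm ?subr_ge0 ?H.
move=> s0 st tl; rewrite -(@Rintegral_itv_cst _ false false) //.
apply: (@enorm_increment_le _ _ l C `|L|) => //.
move: gamL dg; apply: filterS2; first exact: (ae_filter_ringOfSetsType lebesgue_measure).
move=> x gx dgx /[dup] xl /andP[x0 xl']; exists (g x); first exact: dgx.
by rewrite -(cderiv_interior xl (dgx xl)) gx // in_itv /= !ltW.
Qed.

(** The geodesic has constant speed and is no longer than sigma1, which is a competitor
    for the distance to N after reparametrization over [0, 1]. *)
Lemma minimizing_geodesic_speed (R : realType) (k m : nat) (M N : set 'rV[R]_k) (l L : R)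
    (sig1 sig2 : R -> 'rV[R]_k) : submanifold m M -> 0 < l ->
  (forall t, 0 <= t <= l -> M (sig1 t)) ->
  (forall s t, 0 <= s <= l -> 0 <= t <= l -> enorm (sig1 s - sig1 t) <= L * `|s - t|) ->
  N (sig1 l) -> minimizing_geodesic_to m M N l (sig1 0) sig2 ->
  enorm (cderiv `[0, l] sig2 l) <= L.
Proof.
move=> subM l0 sig1M lip1 Nl [geo _ _ len2].
(* [rdist] is defined by curves on [0, 1]. *)
pose tau t := sig1 (l * t).
have in_l t : 0 <= t <= 1 -> 0 <= l * t <= l.
  by move=> /andP[t0 t1]; rewrite mulr_ge0 ?(ltW l0) //= ler_piMr // ltW.
have lip_tau s t : 0 <= s <= 1 -> 0 <= t <= 1 -> enorm (tau s - tau t) <= (L * l) * `|s - t|.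
  move=> s1 t1; apply: le_trans (lip1 _ _ (in_l _ s1) (in_l _ t1)) _.
  by rewrite -mulrBr normrM (gtr0_norm l0) mulrA.
have : ((curve_length l sig2)%:E <= (L * l)%:E)%E.
  rewrite len2; apply: (@le_trans _ _ (rdist M (sig1 0) (sig1 l))).
    by apply: ereal_inf_lbound; exists (sig1 l).
  apply: (@le_trans _ _ (curve_length 1 tau)%:E).
    apply: ereal_inf_lbound; exists tau => //; split.
    - exact: enorm_lipschitz lip_tau.
    - by move=> t; rewrite in_itv /= => t1; apply: sig1M; exact: in_l.
    - by rewrite /tau mulr0.
    - by rewrite /tau mulr1.
  by rewrite lee_fin -[leRHS]mulr1; exact: curve_length_le lip_tau.
rewrite lee_fin /curve_length.
rewrite (@eq_Rintegral _ _ _ _ _ (cst (enorm (cderiv `[0, l] sig2 l)))); last first.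
  by move=> t; rewrite inE /= in_itv /= => tl; exact: geodesic_speed geo _ tl.
by rewrite Rintegral_itv_cst ?(ltW l0) // subr0 ler_pM2r.
Qed.

(** Freezing the argument at the ends of [0, l] turns a Lipschitz map on the interval
    into a continuous map on the line. *)
Lemma measurable_clamp (R : realType) (k : nat) (l : R) (f : R -> 'rV[R]_k) (c : R -> R) i :
  lipschitz_in l f -> (forall x, 0 <= c x <= l) -> (forall x y, `|c x - c y| <= `|x - y|) ->
  measurable_fun setT (fun t => f (c t) 0 i).
Proof.
move=> [C C0 HC] c_in c_lip; apply: continuous_measurable_fun => x.
apply/cvgrPdist_le => e e0; have C1 : 0 < C + 1 by lra.
near=> y.
have xy : `|x - y| <= e / (C + 1).
  near: y; apply: (@cvgr_dist_le _ _ _ _ _ id) => //.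
  by rewrite divr_gt0.
apply: le_trans (_ : enorm (f (c x) - f (c y)) <= _).
  apply: le_trans (ler_norm_enorm _).
  by apply: le_trans (ler_coord_norm _ i); rewrite !mxE.
apply: le_trans (HC _ _ (c_in x) (c_in y)) _.
apply: le_trans (ler_wpM2l C0 (c_lip x y)) _.
move: xy; rewrite ler_pdivlMr //; apply: le_trans.
by rewrite mulrC ler_wpM2l // lerDl.
Unshelve. all: by end_near.
Qed.

(** Integrating the bound on Psi' gives 0 <= Psi l - Psi 0 <= E(sig1) - E(sig2) - th dist^2. *)
Lemma energy_gap_of_potential (R : realType) (k : nat) (l th : R) (sig1 sig2 g1 g2 : R -> 'rV[R]_k)
    (Psi : R -> R) : 0 < l -> 0 <= th ->
  lipschitz_in l sig1 -> lipschitz_in l sig2 -> velocity l sig1 g1 -> velocity l sig2 g2 ->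
  rlipschitz_in l Psi -> Psi 0 <= Psi l ->
  {ae @lebesgue_measure R, forall t, 0 < t < l -> exists2 d : R, is_derive t 1 Psi d &
    d <= dot (g1 t) (g1 t) - dot (g2 t) (g2 t) -
      th * (dot (sig1 t - sig2 t) (sig1 t - sig2 t) + dot (g1 t - g2 t) (g1 t - g2 t))} ->
  th * sqdist_curves l sig1 sig2 <= energy l sig1 - energy l sig2.
Proof.
move=> l0 th0 lip1 lip2 vg1 vg2 [P P0 lipP] Psi_le dPsi.
have [mg1 [B1 g1B] _] := vg1; have [mg2 [B2 g2B] _] := vg2.
have lipD := lipschitz_inB lip1 lip2.
have [c [c_in c_id _ c_lip]] := clampP l0.
pose D t := sig1 (c t) - sig2 (c t).
have [BD BD0 DB] := lipschitz_bounded (ltW l0) lipD.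
have mD i : measurable_fun setT (fun t => D t 0 i) by exact: measurable_clamp lipD c_in c_lip.
have mg12 i : measurable_fun setT (fun t => (g1 t - g2 t) 0 i).
  rewrite (_ : (fun t => _) = (fun t => g1 t 0 i - g2 t 0 i)).
    exact: measurable_funB.
  by apply/funext => t; rewrite !mxE.
have dot_bound (f : R -> 'rV[R]_k) (B : R) : (forall t, enorm (f t) <= B) ->
    forall t, `|dot (f t) (f t)| <= B ^+ 2.
  move=> fB t; rewrite ger0_norm ?dot_ge0 // -sqr_enorm.
  by rewrite ler_sqr ?nnegrE ?enorm_ge0 // (le_trans _ (fB t)) ?enorm_ge0.
have E1b := dot_bound _ _ g1B; have E2b := dot_bound _ _ g2B.
have Db : forall t, `|dot (D t) (D t)| <= BD ^+ 2 by apply: dot_bound => t; exact: DB.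
have g12B t : enorm (g1 t - g2 t) <= B1 + B2.
  by apply: le_trans (ler_enormB _ _) _; exact: lerD.
have Gb := dot_bound _ _ g12B.
have mE1 : measurable_fun setT (fun t => dot (g1 t) (g1 t)) by exact: measurable_dot.
have mE2 : measurable_fun setT (fun t => dot (g2 t) (g2 t)) by exact: measurable_dot.
have mDD : measurable_fun setT (fun t => dot (D t) (D t)) by exact: measurable_dot.
have mG : measurable_fun setT (fun t => dot (g1 t - g2 t) (g1 t - g2 t)) by exact: measurable_dot.
pose S t := dot (D t) (D t) + dot (g1 t - g2 t) (g1 t - g2 t).
have mS : measurable_fun setT S by exact: measurable_funD.
have Sb t : `|S t| <= BD ^+ 2 + (B1 + B2) ^+ 2.
  by apply: le_trans (ler_normD _ _) _; exact: lerD.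
have energyE (sig g : R -> 'rV[R]_k) (B : R) : velocity l sig g ->
    (forall t, `|dot (g t) (g t)| <= B) ->
    energy l sig = \int[@lebesgue_measure R]_(t in `]0, l]) dot (g t) (g t).
  move=> vg gB; have [mg _ _] := vg.
  rewrite /energy (@Rintegral_velocity _ _ _ _ g (fun _ v => enorm v ^+ 2)) //; last first.
  - by rewrite (_ : (fun t => _) = (fun t => dot (g t) (g t)));
      [exact: measurable_dot|apply/funext => t; rewrite sqr_enorm].
  - by move=> t v; exact: sqr_ge0.
  rewrite -Rintegral_itv_obnd_cbnd; last first.
    rewrite (_ : _ \o _ = EFin \o (fun t => dot (g t) (g t))).
      by apply: itv_bounded_integrable gB; exact: measurable_dot.
    by apply/funext => t /=; rewrite sqr_enorm.
  by apply: eq_Rintegral => t _; rewrite sqr_enorm.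
have sqdistE : sqdist_curves l sig1 sig2 = \int[@lebesgue_measure R]_(t in `]0, l]) S t.
  rewrite Rintegral_itv_obnd_cbnd; last exact: itv_bounded_integrable Sb.
  congr fine; apply: ge0_ae_eq_integral_rep => //.
  - by apply/measurable_EFinP; exact: measurable_funTS.
  - by move=> t _; rewrite lee_fin addr_ge0 // sqr_ge0.
  - by move=> t _; rewrite lee_fin addr_ge0 // dot_ge0.
  move: (velocity_cderiv vg1) (velocity_cderiv vg2); apply: filterS2.
    exact: (ae_filter_ringOfSetsType lebesgue_measure).
  move=> t H1 H2; rewrite /= in_itv /= => tl; rewrite H1 // H2 // !sqr_enorm.
  by have /andP[t0 tl'] := tl; rewrite /S /D c_id.
rewrite (energyE sig1 g1 _ vg1 E1b) (energyE sig2 g2 _ vg2 E2b) sqdistE.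
have i1 := @itv_bounded_integrable R false false 0 l _ _ mE1 E1b.
have i2 := @itv_bounded_integrable R false false 0 l _ _ mE2 E2b.
have iS := @itv_bounded_integrable R false false 0 l _ _ mS Sb.
pose F t := dot (g1 t) (g1 t) - dot (g2 t) (g2 t) - th * S t.
have mF : measurable_fun setT F.
  by apply: measurable_funB; [exact: measurable_funB|exact: measurable_funM].
have Fb t : `|F t| <= B1 ^+ 2 + B2 ^+ 2 + th * (BD ^+ 2 + (B1 + B2) ^+ 2).
  apply: le_trans (ler_normB _ _) _; apply: lerD.
    by apply: le_trans (ler_normB _ _) _; exact: lerD.
  by rewrite normrM ger0_norm // ler_wpM2l.
have : Psi l - Psi 0 <= \int[@lebesgue_measure R]_(t in `]0, l]) F t.
  apply: (@lipschitz_ae_le _ l P _ Psi F 0 l l0 lipP mF Fb) => //; last exact: ltW.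
  move: dPsi; apply: filterS; first exact: (ae_filter_ringOfSetsType lebesgue_measure).
  move=> t H /[dup] tl /H[d dP dle]; exists d => //.
  by move: tl => /andP[t0 tl]; rewrite /F /S /D c_id ?(ltW t0) ?(ltW tl).
have mI : measurable (`]0, l]%classic : set R) by exact: measurable_itv.
have -> : \int[@lebesgue_measure R]_(t in `]0, l]) F t =
    \int[@lebesgue_measure R]_(t in `]0, l]) dot (g1 t) (g1 t) -
    \int[@lebesgue_measure R]_(t in `]0, l]) dot (g2 t) (g2 t) -
    th * \int[@lebesgue_measure R]_(t in `]0, l]) S t.
  rewrite -RintegralB // -RintegralZl // -RintegralB //.
    apply: (@itv_bounded_integrable _ _ _ _ _ (B1 ^+ 2 + B2 ^+ 2)); first exact: measurable_funB.
    by move=> t; apply: le_trans (ler_normB _ _) _; exact: lerD.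
  apply: (@itv_bounded_integrable _ _ _ _ _ (th * (BD ^+ 2 + (B1 + B2) ^+ 2))).
    exact: measurable_funM.
  by move=> t; rewrite normrM ger0_norm // ler_wpM2l.
move: Psi_le; lra.
Qed.

Lemma is_derive_inverse_shift (R : realType) (a t : R) : t + a != 0 ->
  is_derive t 1 (fun s => (s + a)^-1) (- (t + a)^-1 ^+ 2).
Proof.
move=> ta; have ? : is_derive t 1 (fun s => s + a) 1.
  by apply: is_derive_eq; rewrite addr0.
have dV : derivable (fun s => (s + a)^-1) t 1.
  by apply: derivableV => //; exact: ex_derive.
split => //; rewrite (@deriveV _ _ (fun s => s + a)) // derive_val.
by rewrite /GRing.scale /= mulr1 exprVn.
Qed.

Lemma is_derive_potential (R : realType) (k : nat) (b D : R -> 'rV[R]_k)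
    (b' D' : 'rV[R]_k) (a t : R) :
  t + a != 0 -> is_derive t 1 b b' -> is_derive t 1 D D' ->
  is_derive t 1 (fun s => 2 * dot (b s) (D s) + 3 / 4 * (s + a)^-1 * dot (D s) (D s))
    (2 * (dot b' (D t) + dot (b t) D') +
     (- (3 / 4) * (t + a)^-1 ^+ 2 * dot (D t) (D t) + 3 / 4 * (t + a)^-1 * (2 * dot (D t) D'))).
Proof.
move=> ta db dD.
have := is_derive_dot db dD; set P := fun s => dot (b s) (D s) => dP.
have := is_derive_dot dD dD; set Q := fun s => dot (D s) (D s) => dQ.
have := is_derive_inverse_shift ta; set W := fun s => (s + a)^-1 => dW.
change (is_derive t 1 (fun s => 2 * P s + 3 / 4 * W s * Q s)
  (2 * (dot b' (D t) + dot (b t) D') +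
     (- (3 / 4) * (t + a)^-1 ^+ 2 * Q t + 3 / 4 * W t * (2 * dot (D t) D')))).
apply: is_derive_eq; rewrite (dotC D' (D t)) /GRing.scale /= /W.
move: (dot _ D') (dot (b t) D') (dot b' _) (Q t) => x y z q.
by field.
Qed.

Theorem lemma3p2 (R : realType) (K m n : nat) (M N : set 'rV[R]_K)
    (M_submanifold : submanifold m M)
    (M_complete : complete_submanifold M)
    (M_homogeneously_regular : homogeneously_regular m M)
    (N_submanifold : submanifold n N)
    (N_sub_M : N `<=` M)
    (N_compact : compact N)
    (M1_M : (sup_sff m M <= (16^-1)%:E)%E)
    (M1_N : (sup_sff n N <= (16^-1)%:E)%E)
    (M2_injectivity : (8%:E <= injectivity_radius m M)%E)
    (M2_curvature : sectional_curvature_le m M 64^-1)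
    (M2'_injectivity : (4%:E <= injectivity_radius n N)%E)
    (M2'_focal : (4%:E <= focal_radius m M n N)%E)
    (M2'_unique : forall p, M p -> (rdist_set M N p <= 2%:E)%E ->
      unique_minimizing_geodesic_to m M N p)
    (M3_M : forall x y, M x -> M y -> enorm (x - y) <= 8 ->
      (rdist M x y <= (2 * enorm (x - y))%:E)%E)
    (M3_N : forall x y, N x -> N y -> enorm (x - y) <= 8 ->
      (rdist N x y <= (2 * enorm (x - y))%:E)%E)
    (L : nat) (L_gt0 : (0 < L)%N) :
  exists C' : R, forall (l : R) (sigma1 sigma2 : R -> 'rV[R]_K),
    0 < l -> l <= L%:R^-1 ->
    (forall t, t \in `[0, l] -> M (sigma1 t)) ->
    [lipschitz sigma1 t | t in `[0, l]] ->
    {ae @lebesgue_measure R, forall t, t \in `[0, l] ->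
      enorm (cderiv `[0, l] sigma1 t) <= L%:R} ->
    N (sigma1 l) ->
    minimizing_geodesic_to m M N l (sigma1 0) sigma2 ->
    orthogonal_to (cderiv `[0, l] sigma2 l) (tangent n N (sigma2 l)) ->
    sqdist_curves l sigma1 sigma2 <= C' * (energy l sigma1 - energy l sigma2).
Proof.
(* 20 is the inverse of the factor 1/20 in [weight_inequality]. *)
exists 20 => l sig1 sig2 l0 lL M1 lip1' ae1 N1 mini b_perp.
have sig1M t : 0 <= t <= l -> M (sig1 t) by move=> tl; apply: M1; rewrite in_itv.
have L1 : 1 <= L%:R :> R by rewrite ler1n.
move: (L%:R : R) L1 lL ae1 => {L_gt0}{}L L1 lL ae1.
have L0 : 0 < L by lra.
have lL1 : l * L <= 1 by rewrite -ler_pdivlMr // div1r.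
have lip1 := ae_speed_lipschitz l0 lip1' ae1.
have v_le := minimizing_geodesic_speed M_submanifold l0 sig1M lip1 N1 mini.
have [geo sig20 N2 _] := mini.
set b := cderiv `[0, l] sig2 in b_perp v_le.
pose b' := cderiv `[0, l] b.
have A0 : 0 <= 16^-1 :> R by rewrite invr_ge0.
have Ac : 16^-1 < 12^-1 :> R by rewrite ltf_pV2 ?posrE // ltr_nat.
have v2_le : enorm (b l) ^+ 2 <= L ^+ 2.
  by rewrite ler_sqr ?nnegrE ?enorm_ge0 // ltW.
have b'_le t : 0 < t < l -> enorm (b' t) <= 12^-1 * L ^+ 2.
  move=> tl; apply: le_trans (geodesic_acceleration_le M_submanifold l0 geo A0 Ac M1_M tl) _.
  by rewrite ler_wpM2l // invr_ge0.
have lip2 := geodesic_lipschitz M_submanifold l0 geo.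
have lip_b : lipschitz_in l b.
  apply: (@lipschitz_inE _ _ _ (12^-1 * L ^+ 2)).
  apply: (@interior_lipschitz R K l (12^-1 * L ^+ 2) b b' _ b'_le).
    by move=> t tl; have [] := geodesic_derive l0 geo tl.
  by have [] := geodesic_continuous l0 geo.
have [g1 vg1] := lipschitz_velocity l0 lip1.
have [g2 vg2] := lipschitz_velocity l0 lip2.
have lipD := lipschitz_inB (lipschitz_inE lip1) (lipschitz_inE lip2).
pose D t := sig1 t - sig2 t.
have D0 : D 0 = 0 by rewrite /D sig20 subrr.
have D_le t : 0 <= t <= l -> enorm (D t) <= 8.
  move=> /[dup] tl /andP[t0 tl'].
  have z : 0 <= (0 : R) <= l by apply/andP; split; [exact: lexx|exact: ltW].
  rewrite (_ : D t = (sig1 t - sig1 0) - (sig2 t - sig2 0)); last first.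
    by rewrite sig20 opprB addrA subrK.
  apply: le_trans (ler_enormB _ _) _.
  have tL : t * L <= 1 by apply: le_trans lL1; rewrite ler_wpM2r // ltW.
  have := lip1 t 0 tl z; have := lip2 t 0 tl z.
  rewrite !subr0 !(ger0_norm t0) => h2 h1.
  have h3 := ler_wpM2r t0 v_le.
  by move: h1 h2 h3 tL; rewrite (mulrC L t); lra.
(* With t <= 1 / L this shift bounds the weight below by (10/11) L, and keeps it finite at 0. *)
pose a := 10^-1 / L.
have a0 : 0 < a by rewrite divr_gt0.
have weight_ge t : 0 <= t <= l -> 10 / 11 * L <= (t + a)^-1.
  move=> /andP[t0 tl]; have ta : 0 < t + a by lra.
  rewrite -[leRHS]mul1r ler_pdivlMr //.
  have -> : 10 / 11 * L * (t + a) = 10 / 11 * (L * t + L * a) by ring.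
  have -> : L * a = 10^-1 by rewrite mulrC divfK // gt_eqF.
  by have : L * t <= 1; [rewrite mulrC; apply: le_trans lL1; rewrite ler_wpM2r // ltW|lra].
pose Psi t := 2 * dot (b t) (D t) + 3 / 4 * (t + a)^-1 * dot (D t) (D t).
have lipPsi : rlipschitz_in l Psi.
  have lip_cst (x : R) : rlipschitz_in l (fun=> x).
    by exists 0 => // s t _ _; rewrite subrr normr0 mul0r.
  apply: rlipschitzD; apply: rlipschitzM; rewrite ?(ltW l0) //.
  - exact: (rlipschitz_dot (ltW l0) lip_b lipD).
  - by apply: rlipschitzM; rewrite ?(ltW l0) //; exact: rlipschitz_inverse_shift.
  - exact: (rlipschitz_dot (ltW l0) lipD lipD).
have Psi0 : Psi 0 = 0 by rewrite /Psi D0 !dot0r !mulr0 addr0.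
have l_in : 0 <= l <= l by rewrite lexx ltW.
(* 2 <b l, D l> >= - (2/3) L |D l|^2, and (3/4) (10/11) > 2/3. *)
have Psil : 0 <= Psi l.
  have := normal_deviation N_submanifold M1_N M3_N N2 N1 (D_le _ l_in) b_perp.
  rewrite -/(D l) sqr_enorm => h.
  have X0 := dot_ge0 (D l).
  have h1 : - dot (b l) (D l) <= 3^-1 * dot (D l) (D l) * L.
    apply: le_trans (ler_norm _) _; rewrite normrN; apply: le_trans h _.
    by rewrite ler_wpM2l // mulr_ge0 // invr_ge0.
  have h2 := ler_wpM2r X0 (weight_ge _ l_in).
  rewrite /Psi -mulrA; move: h1 h2 X0.
  move: (dot _ _) (dot (D l) _) ((l + a)^-1) => p X w h1 h2 X0.
  have h3 : 0 <= L * X by rewrite mulr_ge0 // ltW.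
  rewrite -!mulrA in h1 h2; rewrite (mulrC X L) in h1; move: (L * X) (w * X) h1 h2 h3 => *; lra.
have gap := @energy_gap_of_potential _ _ l 20^-1 sig1 sig2 g1 g2 Psi l0.
rewrite -ler_pdivrMl //; apply: gap => //.
- exact: lipschitz_inE lip1.
- exact: lipschitz_inE lip2.
- by rewrite Psi0.
have [_ _ dg1] := vg1; have [_ _ dg2] := vg2.
move: dg1 dg2; apply: filterS2; first exact: (ae_filter_ringOfSetsType lebesgue_measure).
move=> t /= H1 H2 tl; have dsig1 := H1 tl; have dsig2 := H2 tl.
have [t0 tl'] := andP tl; have tl2 : 0 <= t <= l by rewrite !ltW.
have [db2 db] := geodesic_derive l0 geo tl.
have g2b : g2 t = b t.
  by rewrite -(@derive_val _ _ _ _ _ _ _ dsig2) (@derive_val _ _ _ _ _ _ _ db2).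
have ta : t + a != 0 by rewrite gt_eqF // addr_gt0.
have dD : is_derive t 1 D (g1 t - g2 t) by exact: is_deriveB.
have dPsi := is_derive_potential ta db dD.
eexists; first exact: dPsi.
have g1E : g1 t = b t + (g1 t - g2 t) by rewrite g2b addrC subrK.
have E1 : dot (g1 t) (g1 t) = dot (b t + (g1 t - g2 t)) (b t + (g1 t - g2 t)) by rewrite -g1E.
have E2 : dot (g2 t) (g2 t) = dot (b t) (b t) by rewrite g2b.
rewrite E1 E2.
suff hyp : `|dot (b' t) (D t)| <= 36^-1 * L ^+ 2 * dot (D t) (D t).
  exact: (weight_inequality (g1 t - g2 t) (b t) L1 (weight_ge _ tl2) hyp).
have := normal_deviation M_submanifold M1_M M3_M (geodesic_subset geo tl2) (sig1M _ tl2)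
  (D_le _ tl2) (geodesic_acceleration_normal geo tl2).
rewrite -/(D t) sqr_enorm => /le_trans; apply.
have X0 := dot_ge0 (D t).
apply: le_trans (ler_wpM2l _ (b'_le _ tl)) _; first by rewrite mulr_ge0 // invr_ge0.
by move: (dot _ _) => X; rewrite le_eqVlt; apply/orP; left; apply/eqP; field.
Qed.
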